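(* Let $p(n)=\sum_{i=0}^k a_i n^i$ be a polynomial with real coefficients such that at least one of $a_1,\dots,a_k$ is irrational, and let $d\in\mathbb{R}$ be arbitrary. Then the sequences $\{p(n) \bmod 1\}_{n\geq 1}$ and $\{2^n d\bmod 1\}_{n\geq 1}$ are arithmetically independent. Moreover, \[\dim_{\mathrm{H}} \overline{\{p(n)+2^n d \bmod 1: n\geq 1\}}=1.\]
   Context: For a real number $x$, $x\bmod 1$ denotes the unique $a\in[0,1)$ with $a-x\in\mathbb{Z}$. For a sequence $\{x_n\}_{n\ge1}$, we also write $\{x_n\}_{n\ge 1}$ for the set of its values. Two sequences $x=\{x_n\}_{n\geq 1}$, $y=\{y_n\}_{n\geq 1}$ in $[0,1]$, with value sets $X$ and $Y$, are called arithmetically independent if the set $H(x,y)$ of values of the sequence $\{x_n+y_n\}_{n\geq 1}$ satisfies $\underline{\dim_{\mathrm{B}}} H(x,y)=\min\{1, \underline{\dim_{\mathrm{B}}} X+\underline{\dim_{\mathrm{B}}} Y\}$, where $\underline{\dim_{\mathrm{B}}}$ is lower box-counting dimension and $\dim_{\mathrm{H}}$ is Hausdorff dimension. *)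

(* Defs.v *)
From HB Require Import structures.
From mathcomp Require Import all_boot all_order all_algebra.
From mathcomp Require Import all_classical all_reals all_analysis.

Set Implicit Arguments.
Unset Strict Implicit.
Unset Printing Implicit Defensive.

Import Order.TTheory GRing.Theory Num.Theory.
Import numFieldNormedType.Exports.

Local Open Scope classical_set_scope.
Local Open Scope ring_scope.

Definition mod1 (R : realType) (x : R) : R := x - (Num.floor x)%:~R.

(* Sequences are indexed by n >= 1; the term of index 0 is ignored. *)
Definition value_set (R : realType) (x : nat -> R) : set R :=
  [set x n | n in [set n | (1 <= n)%N]].

(* Extended-real valued, so that unbounded sets have diameter +oo. The
   diameter of the empty set is -oo, below every bound. *)
Definition diam (R : realType) (U : set R) : \bar R :=
  ereal_sup [set `|z.1 - z.2|%:E | z in U `*` U].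

(* Least number of sets of diameter at most delta needed to cover A; it is
   +oo if there is no finite cover. *)
Definition covering_number (R : realType) (A : set R) (delta : R) : \bar R :=
  ereal_inf [set n%:R%:E | n in
    [set n | exists U : 'I_n -> set R,
       A `<=` \bigcup_i U i /\ forall i, (diam (U i) <= delta%:E)%E]].

Definition lower_box_dim (R : realType) (A : set R) : \bar R :=
  limf_einf (fun delta : R => (lne (covering_number A delta) / (- ln delta)%:E)%E)
            (0 : R)^'+.

(* diam(U)^s, where the empty set contributes 0 even when s = 0. *)
Definition diam_pow (R : realType) (s : R) (U : set R) : \bar R :=
  if U == set0 then 0%E else (diam U `^ s)%E.

Definition hausdorff_content (R : realType) (s delta : R) (A : set R) : \bar R :=
  ereal_inf [set (\sum_(0 <= n <oo) diam_pow s (U n))%E | U in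
    [set U : nat -> set R |
       A `<=` \bigcup_n U n /\ forall n, (diam (U n) <= delta%:E)%E]].

(* The contents increase as delta decreases to 0, so their limit is a
   supremum. *)
Definition hausdorff_measure (R : realType) (s : R) (A : set R) : \bar R :=
  ereal_sup [set hausdorff_content s delta A | delta in [set delta | 0 < delta]].

Definition hausdorff_dim (R : realType) (A : set R) : \bar R :=
  ereal_inf [set s%:E | s in [set s | 0 <= s /\ hausdorff_measure s A = 0%E]].

(* The termwise sum lives in [0, 2]: it is not reduced modulo 1. *)
Definition arithmetically_independent (R : realType) (x y : nat -> R) : Prop :=
  [/\ forall n, (1 <= n)%N -> 0 <= x n <= 1,
      forall n, (1 <= n)%N -> 0 <= y n <= 1 &
      lower_box_dim (value_set (fun n => x n + y n)) =
      mine 1%E (lower_box_dim (value_set x) + lower_box_dim (value_set y))%E].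

(* Main.v *)
Require Import Defs.
From HB Require Import structures.
From mathcomp Require Import all_boot all_order all_algebra.
From mathcomp Require Import all_classical all_reals all_analysis.
From mathcomp Require Import ring lra zify.
Set Implicit Arguments.
Unset Strict Implicit.
Unset Printing Implicit Defensive.
Import Order.TTheory GRing.Theory Num.Theory.
Import numFieldNormedType.Exports.
Local Open Scope classical_set_scope.
Local Open Scope ring_scope.

(* Suppose that the points [p(n) + 2^n d] mod 1 are covered by finitely many
   intervals [U_i] of lengths [2^-l_i] with [sum_i 2^(-s l_i)] tiny and [s < 1].
   Let [lambda] be the growth rate of the number of words of length [l] in the
   binary expansion of [d].  Knowing the trajectory of [p] along a window, every
   cover element containing [p(n) + 2^n d] determines the next [l_i] binary
   digits of [2^n d] up to a bounded ambiguity, so the words of length [M] can be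
   parsed into blocks read off from the cover.  By the uniform equidistribution
   of [p(n)] mod 1, at most positions the total weight of the admissible blocks,
   a block of length [l] being weighted by [b^l] with [b > 1/lambda], is less
   than 1; hence there are at most [b^-M] words of length [M], up to a factor
   [C^M] with [C] close to 1, along windows with a given trajectory.  The
   trajectories of length [M] fall into polynomially many classes, which
   contradicts the fact that there are at least [lambda^M] words.  Both
   dimensions of the sum are therefore 1, and the case [d = 0] gives the box
   dimension of the polynomial sequence. *)

(** * Weyl sums *)

(** The free phase [phi] makes the cosine bound as strong as a bound on the modulus of the
    exponential sum. The threshold [T0] is uniform in the start [N] of the window. *)
Definition weyl_null (R : realType) (x : nat -> R) :=
  forall eta : R, 0 < eta -> exists T0, forall T N phi, (T0 <= T)%N ->
    \sum_(j < T) cos (pi *+ 2 * x (N + j)%N + phi) <= eta * T%:R.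

Lemma cosD2pi_int (R : realType) (a : R) (m : int) :
  cos (a + pi *+ 2 * m%:~R) = cos a.
Proof.
case: m => n.
  by rewrite -pmulrn mulr_natr (periodicn (@cosD2pi R)).
rewrite NegzE mulrNz -pmulrn mulrN mulr_natr.
by rewrite -[in RHS](subrK (pi *+ 2 *+ n.+1) a) (periodicn (@cosD2pi R)).
Qed.

Lemma sinD2pi_int (R : realType) (a : R) (m : int) :
  sin (a + pi *+ 2 * m%:~R) = sin a.
Proof.
by rewrite -!cosBpihalf addrAC cosD2pi_int.
Qed.

(** The identity cos(2 pi b) = 1 - 2 sin(pi b)^2 passes the hypothesis on to the fractional part of
    [a], and the sine is positive on (0, pi). *)
Lemma sin_pi_eq0_int (R : realType) (a : R) :
  sin (pi * a) = 0 -> exists m : int, a = m%:~R.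
Proof.
move=> s0; exists (Num.floor a).
set f := a - (Num.floor a)%:~R.
have f0 : 0 <= f by rewrite subr_ge0 floor_le_tmp.
have f1 : f < 1 by rewrite ltrBlDr addrC; have := floorD1_gt a; rewrite intrD.
have c1 (b : R) : cos (pi *+ 2 * b) = 1 - (sin (pi * b) ^+ 2) *+ 2.
  have -> : pi *+ 2 * b = (pi * b) *+ 2 by rewrite mulrnAl.
  rewrite cos_mulr2n cos2sin2; ring.
have : sin (pi * f) = 0.
  have := c1 f; rewrite /f mulrBr -mulrN -mulrNz cosD2pi_int c1 s0 -/f => h.
  by apply/eqP; rewrite -sqrf_eq0; apply/eqP; lra.
move: f0; rewrite le_eqVlt => /orP[/eqP f0 _|f0 sf]; first by rewrite /f in f0; lra.
have : 0 < sin (pi * f).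
  apply: sin_gt0_pi; rewrite mulr_gt0 ?pi_gt0//=.
  by rewrite -[ltRHS]mulr1 ltr_pM2l// pi_gt0.
by rewrite sf ltxx.
Qed.

Lemma shift_sum_le (R : realType) (g : nat -> R) (T h : nat) :
  (forall n, `|g n| <= 1) ->
  `|\sum_(n < T) g (n + h)%N - \sum_(n < T) g n| <= 2 * h%:R.
Proof.
move=> g1; elim: h => [|h IH].
  by under eq_bigr do rewrite addn0; rewrite subrr normr0 mulr0.
have -> : \sum_(n < T) g (n + h.+1)%N =
    \sum_(n < T) g (n + h)%N + (g (T + h)%N - g h).
  elim: T {IH} => [|T IH]; first by rewrite !big_ord0 add0n subrr addr0.
  by rewrite !big_ord_recr/= IH addSnnS; ring.
rewrite addrAC (le_trans (ler_normD _ _))// -(natr1 h) mulrDr mulr1.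
apply: lerD => //; rewrite (le_trans (ler_normB _ _))//.
by have := g1 (T + h)%N; have := g1 h; lra.
Qed.

(** Multiplication by [2 * sin (pi * a)], nonzero because [a] is not an integer, turns each cosine
    into a difference of sines [q] indices apart. The sum telescopes to at most [2 * q]. *)
Lemma weyl_null_linear (R : realType) (x : nat -> R) (q : nat) (a : R) :
  (forall m : int, a <> m%:~R) ->
  (forall n, exists m : int, x (n + q)%N = x n + a + m%:~R) ->
  weyl_null x.
Proof.
move=> aZ xq eta eta0.
set s := sin (pi * a).
have s0 : s != 0 by apply/eqP => /sin_pi_eq0_int[m]; exact: aZ.
exists (Num.truncn (q%:R / `|s| / eta)).+1 => T N phi TT.
pose g n := sin (pi *+ 2 * x (N + n)%N + phi - pi * a).
have gE n : g (n + q)%N - g n = 2 * s * cos (pi *+ 2 * x (N + n)%N + phi).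
  rewrite /g addnA; have [m ->] := xq (N + n)%N.
  rewrite !mulrDr.
  have -> : pi *+ 2 * x (N + n)%N + pi *+ 2 * a + pi *+ 2 * m%:~R + phi - pi * a
    = (pi *+ 2 * x (N + n)%N + phi) + pi * a + pi *+ 2 * m%:~R.
    by rewrite mulr2n; ring.
  by rewrite sinD2pi_int sinD sinB -/s; ring.
have g1 n : `|g n| <= 1 by exact: sin_max.
have := shift_sum_le T q g1; rewrite -sumrB.
under eq_bigr do rewrite gE.
rewrite -mulr_sumr !normrM (ger0_norm (ler0n _ 2)) -mulrA ler_pM2l//.
rewrite -ler_pdivlMl ?normr_gt0// => h.
apply: (le_trans (ler_norm _)); apply: (le_trans h).
rewrite mulrC -[leRHS]mulrC -ler_pdivrMr//.
apply: (le_trans (ltW (truncnS_gt _))).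
by rewrite ler_nat.
Qed.

(** The right side is the squared modulus of the sum of the exp(i t), that is, the left side plus
    the square of the sum of sines. *)
Lemma sqr_sum_cos_le (R : realType) (I : finType) (t : I -> R) :
  (\sum_i cos (t i)) ^+ 2 <= \sum_i \sum_j cos (t i - t j).
Proof.
have -> : \sum_i \sum_j cos (t i - t j) =
    (\sum_i cos (t i)) ^+ 2 + (\sum_i sin (t i)) ^+ 2.
  rewrite !expr2 !big_distrlr/= -big_split/=; apply: eq_bigr => i _.
  by rewrite -big_split/=; apply: eq_bigr => j _; rewrite cosB.
by rewrite lerDl sqr_ge0.
Qed.

(** Moving the window by the smaller shift leaves only the difference of the shifts, so a maximum
    over finitely many differences gives one threshold. *)
Lemma weyl_null_shift_pair (R : realType) (x : nat -> R) (H : nat) (eta : R) :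
  (forall h, (1 <= h)%N -> weyl_null (fun n => x (n + h)%N - x n)) -> 0 < eta ->
  exists T0, forall T N (h h' : 'I_H), (T0 <= T)%N -> h != h' ->
   \sum_(n < T) cos (pi *+ 2 * x (N + n + h)%N - pi *+ 2 * x (N + n + h')%N)
     <= eta * T%:R.
Proof.
move=> wx eta0.
have /choice[f fP] : forall h, exists k, forall T N phi, (1 <= h)%N -> (k <= T)%N ->
   \sum_(j < T) cos (pi *+ 2 * (x (N + j + h)%N - x (N + j)%N) + phi) <= eta * T%:R.
  move=> [|h]; first by exists 0%N.
  have [T0 T0P] := wx h.+1 isT eta eta0.
  by exists T0 => T N phi _; exact: T0P.
exists (\max_(h < H) f h)%N => T N.
have main (h h' : 'I_H) : ((\max_(h < H) f h)%N <= T)%N -> (h' < h)%N ->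
   \sum_(n < T) cos (pi *+ 2 * x (N + n + h)%N - pi *+ 2 * x (N + n + h')%N)
     <= eta * T%:R.
  move=> TT hh'.
  have fT : (f (h - h') <= T)%N.
    apply: leq_trans TT.
    have lt : (h - h' < H)%N by rewrite (leq_ltn_trans (leq_subr _ _))// ltn_ord.
    by rewrite -[(h - h')%N]/(nat_of_ord (Ordinal lt)) (leq_bigmax (Ordinal lt)).
  have := fP (h - h')%N T (N + h')%N 0 _ fT.
  rewrite subn_gt0 => /(_ hh'); apply: le_trans.
  apply: ler_sum => n _; rewrite addr0 mulrBr.
  have -> : (N + h' + n + (h - h') = N + n + h)%N by move: hh'; lia.
  by rewrite (addnAC N h' n).
move=> h h' TT; rewrite -val_eqE/= neq_ltn => /orP[hh|hh]; last exact: main.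
have := main h' h TT hh; apply: le_trans; apply: ler_sum => n _.
by rewrite -cosN opprB.
Qed.

(* van der Corput's trick, with AM-GM in place of Cauchy-Schwarz *)
Lemma weyl_null_vdc (R : realType) (x : nat -> R) :
  (forall h, (1 <= h)%N -> weyl_null (fun n => x (n + h)%N - x n)) ->
  weyl_null x.
Proof.
move=> wx eta eta0.
(* With this [H] the diagonal contribution H T is at most the off-diagonal allowance H^2 (eta^2 / 8)
   T. *)
have [H [HP H0]] : exists H : nat, 8 / eta ^+ 2 <= H%:R /\ 0 < H%:R :> R.
  exists (Num.truncn (8 / eta ^+ 2)).+1; split; last by rewrite ltr0n.
  exact: ltW (truncnS_gt _).
have e8 : 0 < eta ^+ 2 / 8 by rewrite divr_gt0 ?exprn_gt0.
have [T0 T0P] := @weyl_null_shift_pair _ x H (eta ^+ 2 / 8) wx e8.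
exists (maxn T0 (Num.truncn (4 * H%:R / eta)).+1) => T N phi.
rewrite geq_max => /andP[TT0 TT1].
have T4 : 4 * H%:R <= eta * T%:R.
  rewrite -[leRHS]mulrC -ler_pdivrMr// (le_trans (ltW (truncnS_gt _)))//.
  by rewrite ler_nat.
pose t n := pi *+ 2 * x (N + n)%N + phi.
pose B n := \sum_(h < H) cos (t (n + h)%N).
(* [B n] groups [H] consecutive terms; each shift of the window costs at most [2 * H]. *)
have shiftB : H%:R * \sum_(j < T) cos (t j) <= \sum_(n < T) B n + 2 * H%:R * H%:R.
  rewrite /B exchange_big/= mulr_natl -[X in _ *+ X]card_ord -sumr_const.
  have -> : 2 * H%:R * H%:R = \sum_(i < H) (2 * H%:R) :> R.
    by rewrite sumr_const card_ord mulr_natr.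
  rewrite -big_split/=; apply: ler_sum => h _.
  have := @shift_sum_le _ (fun n => cos (t n)) T h (fun n => cos_max _).
  rewrite ler_norml => /andP[+ _]; rewrite lerBrDl => h1.
  have : h%:R <= H%:R :> R by rewrite ler_nat ltnW.
  lra.
have sqB : \sum_(n < T) B n ^+ 2 <= H%:R * T%:R + H%:R ^+ 2 * (eta ^+ 2 / 8 * T%:R).
  apply: (@le_trans _ _ (\sum_(n < T) \sum_(h < H) \sum_(h' < H)
      cos (t (n + h)%N - t (n + h')%N))).
    by apply: ler_sum => n _; exact: sqr_sum_cos_le.
  rewrite exchange_big/=; under eq_bigr do rewrite exchange_big/=.
  apply: (@le_trans _ _ (\sum_(h < H) \sum_(h' < H)
     (T%:R * (h == h')%:R + eta ^+ 2 / 8 * T%:R))).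
    apply: ler_sum => h _; apply: ler_sum => h' _.
    case: eqVneq => [->|hh'].
      under eq_bigr do rewrite subrr cos0.
      rewrite sumr_const card_ord mulr1 lerDl.
      by rewrite mulr_ge0// ltW.
    rewrite mulr0 add0r; apply: le_trans (T0P T N h h' TT0 hh').
    apply: ler_sum => n _; rewrite /t !addnA.
    by rewrite opprD addrACA subrr addr0.
  rewrite le_eqVlt; apply/orP; left; apply/eqP.
  have rowE (h : 'I_H) : \sum_(h' < H) (T%:R * (h == h')%:R + eta ^+ 2 / 8 * T%:R) =
      T%:R + H%:R * (eta ^+ 2 / 8 * T%:R).
    rewrite big_split/= sumr_const card_ord (bigD1 h)//= eqxx mulr1.
    rewrite big1 ?addr0 ?mulr_natl// => j.
    by rewrite eq_sym => /negPf ->; rewrite mulr0.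
  rewrite (eq_bigr _ (fun h _ => rowE h)) sumr_const card_ord.
  by rewrite -(mulr_natl (_ + _)) mulrDr expr2 mulrA.
have amgm n : B n <= H%:R * eta / 4 + B n ^+ 2 / (H%:R * eta).
  have He : 0 < H%:R * eta by rewrite mulr_gt0.
  rewrite -subr_ge0.
  have -> : H%:R * eta / 4 + B n ^+ 2 / (H%:R * eta) - B n =
     (H%:R * eta / 2 - B n) ^+ 2 / (H%:R * eta).
    by field; rewrite !gt_eqF.
  by rewrite divr_ge0 ?sqr_ge0 ?ltW.
have sB : \sum_(n < T) B n <= H%:R * eta / 2 * T%:R.
  apply: (@le_trans _ _ (\sum_(n < T) (H%:R * eta / 4 + B n ^+ 2 / (H%:R * eta)))).
    by apply: ler_sum => n _; exact: amgm.
  rewrite big_split/= sumr_const card_ord -mulr_suml -mulr_natr.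
  have : (\sum_(i < T) B i ^+ 2) / (H%:R * eta) <= H%:R * eta / 4 * T%:R.
    rewrite ler_pdivrMr ?mulr_gt0//; apply: (le_trans sqB).
    have -> : H%:R * eta / 4 * T%:R * (H%:R * eta) =
      H%:R * T%:R * (H%:R * eta ^+ 2 / 4) by ring.
    have -> : H%:R * T%:R + H%:R ^+ 2 * (eta ^+ 2 / 8 * T%:R) =
      H%:R * T%:R * (1 + H%:R * eta ^+ 2 / 8) by ring.
    rewrite ler_wpM2l// ?mulr_ge0//.
    move: HP; rewrite ler_pdivrMr ?exprn_gt0//; lra.
  lra.
have : H%:R * \sum_(j < T) cos (t j) <= H%:R * (eta * T%:R).
  apply: (le_trans shiftB).
  have : 2 * H%:R * H%:R <= H%:R * (eta * T%:R) / 2.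
    rewrite mulrC -mulrA ler_pM2l//; lra.
  lra.
by rewrite ler_pM2l.
Qed.

(** * Rational coefficients and Weyl sums of polynomials *)

Lemma rationalD (R : realType) (a b : R) : rational a -> rational b -> rational (a + b).
Proof. by move=> [p _ <-] [q _ <-]; exists (p + q) => //; rewrite rmorphD. Qed.

Lemma rationalN (R : realType) (a : R) : rational a -> rational (- a).
Proof. by move=> [p _ <-]; exists (- p) => //; rewrite rmorphN. Qed.

Lemma rationalM (R : realType) (a b : R) : rational a -> rational b -> rational (a * b).
Proof. by move=> [p _ <-] [q _ <-]; exists (p * q) => //; rewrite rmorphM. Qed.

Lemma rationalV (R : realType) (a : R) : rational a -> rational (a^-1).
Proof. by move=> [p _ <-]; exists (p^-1) => //; rewrite fmorphV. Qed.

Lemma rational_int (R : realType) (m : int) : rational (m%:~R : R).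
Proof. by exists m%:~R => //; rewrite ratr_int. Qed.

Lemma rational_nat (R : realType) (m : nat) : rational (m%:R : R).
Proof. exact: (rational_int R m). Qed.

Lemma rational_sum (R : realType) (I : Type) (r : seq I) (P : pred I) (F : I -> R) :
  (forall i, P i -> rational (F i)) -> rational (\sum_(i <- r | P i) F i).
Proof.
move=> FP; elim/big_ind: _ => //; first exact: (rational_nat R 0).
by move=> a b; exact: rationalD.
Qed.

Lemma irrational_mul_nat (R : realType) (a : R) (n : nat) :
  (0 < n)%N -> irrational a -> irrational (a * n%:R).
Proof.
move=> n0 ia ra; apply: ia.
have -> : a = a * n%:R * n%:R^-1 by rewrite mulfK// pnatr_eq0 -lt0n.
by apply: rationalM => //; apply: rationalV; exact: rational_nat.
Qed.

Lemma common_denominator (R : realType) (f : nat -> R) (s : nat) :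
  (forall j, rational (f j)) ->
  exists2 q : nat, (0 < q)%N & forall j, (j < s)%N -> exists m : int, f j * q%:R = m%:~R.
Proof.
move=> rf; elim: s => [|s [q q0 IH]]; first by exists 1%N.
have [a [b fs]] := (rationalP _).1 (rf s).
(* [rationalP] admits the denominator 0, and the quotient is then 0. *)
case: b fs => [|b] fs.
  exists q => // j; rewrite ltnS leq_eqVlt => /orP[/eqP ->|/IH//].
  by exists 0; rewrite fs invr0 mulr0 mul0r.
exists (q * b.+1)%N => [|j]; first by rewrite muln_gt0 q0.
rewrite ltnS leq_eqVlt => /orP[/eqP ->|/IH[m jm]].
  exists (a * q%:Z); rewrite fs natrM intrM (mulrC q%:R) mulrA divfK ?pnatr_eq0//.
by exists (m * b.+1%:Z); rewrite natrM mulrA jm intrM.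
Qed.

(** Let [q] be a common denominator of the coefficients of degree at least 2. Modulo 1, a step of
    length [q] adds [q] times the linear coefficient, which is irrational, and [weyl_null_linear]
    applies. *)
Lemma weyl_null_poly1 (R : realType) (p : {poly R}) :
  irrational p`_1 -> (forall j, (1 < j)%N -> rational p`_j) ->
  weyl_null (fun n => p.[n%:R]).
Proof.
move=> ip rp.
have rp' j : rational (p`_(j + 2)) by apply: rp; rewrite addn2.
have [q q0 qP] := common_denominator (size p) rp'.
apply: (@weyl_null_linear _ _ q (p`_1 * q%:R)).
  move=> m e; apply: (irrational_mul_nat q0 ip); rewrite e; exact: rational_int.
move=> n; suff [m mP] : exists m : int, p.[(n + q)%:R] - p.[n%:R] - p`_1 * q%:R = m%:~R.
  by exists m; rewrite -mP; ring.
have s2 : (1 < size p)%N.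
  rewrite ltnNge; apply/negP => /(nth_default 0) e; apply: ip; rewrite e.
  exact: (rational_nat R 0).
rewrite !horner_coef -sumrB -(subnKC s2) !big_ord_recl/= /bump/= !expr0 !expr1.
rewrite subrr add0r natrD.
rewrite addn0; set S := \sum_(i < _) _.
have -> : p`_1 * (n%:R + q%:R) - p`_1 * n%:R + S - p`_1 * q%:R = S by ring.
rewrite {}/S.
elim/big_ind : _ => [|_ _ [a ->] [b ->]|i _]; first by exists 0.
  by exists (a + b); rewrite intrD.
rewrite -mulrBr !add1n.
have [m im] := qP i (leq_trans (ltn_ord i) (leq_subr _ _)).
rewrite addn2 in im.
(* The difference of the powers of [n + q] and [n] is a multiple of [q], which clears the
   denominator. *)
exists (m * (\sum_(k < i.+2) (n + q) ^ (i.+1 - k) * n ^ k)%N%:Z).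
rewrite intrM -im -mulrA; congr (_ * _).
rewrite subrXX addrC addKr; congr (_ * _).
by rewrite -pmulrn natr_sum; apply: eq_bigr => k _; rewrite natrM !natrX natrD.
Qed.

(** Induction on the index of the highest irrational coefficient, by means of [weyl_null_vdc]. *)
Lemma weyl_null_poly (R : realType) (p : {poly R}) (i : nat) :
  irrational p`_i.+1 -> (forall j, (i.+1 < j)%N -> rational p`_j) ->
  weyl_null (fun n => p.[n%:R]).
Proof.
elim: i p => [|i IH] p ip rp; first exact: weyl_null_poly1.
apply: weyl_null_vdc => -[//|h] _.
have s0 : (i.+2 < size p)%N.
  rewrite ltnNge; apply/negP => /(nth_default 0) e; apply: ip; rewrite e.
  exact: (rational_nat R 0).
(* differencing moves the highest irrational coefficient down by one *)
pose r := \sum_(1 <= j < size p) (h.+1%:R ^+ j) *: p^`N(j).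
have -> : (fun n => p.[(n + h.+1)%:R] - p.[n%:R]) = (fun n => r.[n%:R]).
  apply/funext => n; rewrite natrD nderiv_taylor; last exact: mulrC.
  rewrite -(big_mkord xpredT (fun j => p^`N(j).[n%:R] * h.+1%:R ^+ j)) big_ltn; last first.
    exact: leq_ltn_trans s0.
  rewrite nderivn0 expr0 mulr1 addrC addKr /r horner_sum.
  by apply: eq_bigr => j _; rewrite hornerZ mulrC.
have rE k : r`_k = \sum_(1 <= j < size p) p`_(j + k) * ('C(j + k, j)%:R * h.+1%:R ^+ j).
  rewrite /r coef_sum; apply: eq_bigr => j _.
  by rewrite coefZ coef_nderivn -mulr_natr; ring.
have rat_part j k : rational ('C(j + k, j)%:R * h.+1%:R ^+ j : R).
  by rewrite -natrX -natrM; exact: rational_nat.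
apply: IH => [|k ik]; rewrite rE.
  (* In this coefficient of [r] the term [j = 1] is the irrational coefficient times [i.+2 * h.+1];
     all later terms are rational. *)
  rewrite big_ltn; last exact: leq_ltn_trans s0.
  rewrite add1n bin1 expr1 -natrM => rr.
  apply: (@irrational_mul_nat _ _ (i.+2 * h.+1) _ ip); first by rewrite muln_gt0.
  rewrite -[X in rational X](addrK (\sum_(2 <= j < size p) p`_(j + i.+1) *
    ('C(j + i.+1, j)%:R * h.+1%:R ^+ j))).
  apply: rationalD => //; apply: rationalN; rewrite big_nat_cond; apply: rational_sum => j.
  rewrite andbT => /andP[j2 _]; apply: rationalM => //; apply: rp.
  by rewrite -[i.+2]/(1 + i.+1)%N ltn_add2r.
rewrite big_nat_cond; apply: rational_sum => j.
rewrite andbT => /andP[j2 _]; apply: rationalM => //; apply: rp.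
by move: j2 ik; lia.
Qed.

Lemma weyl_null_poly_irrational (R : realType) (p : {poly R}) :
  (exists i : nat, (1 <= i)%N /\ irrational p`_i) ->
  weyl_null (fun n => p.[n%:R]).
Proof.
move=> [i [i1 ip]].
have nz j : irrational p`_j -> (j < size p)%N.
  rewrite ltnNge => ij; apply/negP => /(nth_default 0) e; apply: ij; rewrite e.
  exact: (rational_nat R 0).
have exP : exists j, `[< irrational p`_j >] by exists i; apply/asboolP.
have ubP j : `[< irrational p`_j >] -> (j <= size p)%N.
  by move=> /asboolP /nz /ltnW.
case: (ex_maxnP exP ubP) => j /asboolP ij jmax.
have : (1 <= j)%N by rewrite (leq_trans i1)// jmax//; apply/asboolP.
case: j ij jmax => // j ij jmax _; apply: (weyl_null_poly ij) => k jk.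
by apply: contrapT => ik; have /asboolP/jmax := ik; rewrite leqNgt jk.
Qed.

(** * Visits to short arcs *)

(** An integer witness, rather than [mod1], spares any special treatment of arcs that wrap around 0
    and lets errors add up by the triangle inequality. *)
Definition near1 (R : realType) (x c rho : R) :=
  exists m : int, `|x - c - m%:~R| <= rho.

Lemma cos_ge_half (R : realType) :
  exists2 delta : R, 0 < delta & forall x, `|x| <= delta -> 1 / 2 <= cos x.
Proof.
have := @continuous_cos R 0 => /cvgrPdist_lt /(_ (1 / 2)).
rewrite cos0 => /(_ (ltac:(by lra)))[/= e e0 eP].
exists (e / 2); first by rewrite divr_gt0.
move=> x xe; have : `|1 - cos x| < 1 / 2.
  by apply: eP; rewrite /ball_/= sub0r normrN; lra.
by rewrite ltr_norml => /andP[_]; lra.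
Qed.

(** When the square is expanded, the [K] diagonal pairs give K T, and each of the at most K^2 other
    pairs gives at most T / K. The centre [c] enters only as a phase, so the threshold does not
    depend on it. *)
Lemma fejer_mean_le (R : realType) (x : nat -> R) (K : nat) : (0 < K)%N ->
  (forall k, (0 < k)%N -> weyl_null (fun n => k%:R * x n)) ->
  exists T0, forall T N c, (T0 <= T)%N ->
   \sum_(j < T) (\sum_(k < K) cos (pi *+ 2 * (k%:R * (x (N + j)%N - c)))) ^+ 2
     <= 2 * K%:R * T%:R.
Proof.
move=> K0 wx.
have /choice[f fP] : forall k, exists T0, forall T N phi, (0 < k)%N -> (T0 <= T)%N ->
   \sum_(j < T) cos (pi *+ 2 * (k%:R * x (N + j)%N) + phi) <= K%:R^-1 * T%:R.
  move=> [|k]; first by exists 0%N.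
  have Ki : 0 < K%:R^-1 :> R by rewrite invr_gt0 ltr0n.
  by have [T0 T0P] := wx k.+1 isT _ Ki; exists T0 => T N phi _; exact: T0P.
exists (\max_(k < K) f k)%N => T N c TT.
have off (k k' : 'I_K) : (k' < k)%N ->
   \sum_(j < T) cos (pi *+ 2 * (k%:R * (x (N + j)%N - c)) -
     pi *+ 2 * (k'%:R * (x (N + j)%N - c))) <= K%:R^-1 * T%:R.
  move=> kk.
  have lt : (k - k' < K)%N by rewrite (leq_ltn_trans (leq_subr _ _))// ltn_ord.
  have fT : (f (k - k') <= T)%N.
    apply: leq_trans TT.
    by rewrite -[(k - k')%N]/(nat_of_ord (Ordinal lt)) (leq_bigmax (Ordinal lt)).
  have := fP (k - k')%N T N (- (pi *+ 2 * ((k - k')%:R * c))) _ fT.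
  rewrite subn_gt0 => /(_ kk); apply: le_trans.
  apply: ler_sum => j _; rewrite natrB ?(ltnW kk)//.
  by rewrite le_eqVlt; apply/orP; left; apply/eqP; congr cos; ring.
apply: (@le_trans _ _ (\sum_(j < T) \sum_(k < K) \sum_(k' < K)
    cos (pi *+ 2 * (k%:R * (x (N + j)%N - c)) - pi *+ 2 * (k'%:R * (x (N + j)%N - c))))).
  by apply: ler_sum => j _; exact: sqr_sum_cos_le.
rewrite exchange_big/=; under eq_bigr do rewrite exchange_big/=.
apply: (@le_trans _ _ (\sum_(k < K) \sum_(k' < K)
    (T%:R * (k == k')%:R + K%:R^-1 * T%:R))).
  apply: ler_sum => k _; apply: ler_sum => k' _.
  case: eqVneq => [->|].
    under eq_bigr do rewrite subrr cos0.
    by rewrite sumr_const card_ord mulr1 lerDl mulr_ge0 ?invr_ge0.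
  rewrite mulr0 add0r -val_eqE/= neq_ltn => /orP[kk|/off//].
  apply: le_trans (off _ _ kk); apply: ler_sum => j _.
  by rewrite -cosN opprB.
have rowE (k : 'I_K) : \sum_(k' < K) (T%:R * (k == k')%:R + K%:R^-1 * T%:R) =
    2 * T%:R :> R.
  rewrite big_split/= sumr_const card_ord (bigD1 k)//= eqxx mulr1.
  rewrite big1 ?addr0 => [|j].
    rewrite -mulrnAl -(mulr_natr K%:R^-1 K) mulVf ?pnatr_eq0 -?lt0n//; ring.
  by rewrite eq_sym => /negPf ->; rewrite mulr0.
rewrite (eq_bigr _ (fun h _ => rowE h)) sumr_const card_ord.
by rewrite -[leLHS]mulr_natr mulrAC.
Qed.

(** A Chebyshev bound. At a visit the first [K] cosines are all at least 1/2, so the square in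
    [fejer_mean_le] is at least K^2 / 4. Its mean is at most 2 K, so the frequency of visits is at
    most 8 / K, with [K] of order 1 / [rho]. *)
Lemma visit_frequency_le (R : realType) (x : nat -> R) :
  (forall k, (0 < k)%N -> weyl_null (fun n => k%:R * x n)) ->
  exists2 C0 : R, 0 < C0 & forall rho : R, 0 < rho -> exists T0, forall T N c, (T0 <= T)%N ->
    \sum_(j < T) (`[< near1 (x (N + j)%N) c rho >])%:R <= C0 * rho * T%:R.
Proof.
move=> wx; have [delta delta0 cosP] := cos_ge_half R.
have pi0 := pi_gt0 R.
have pi20 : 0 <= pi *+ 2 :> R by rewrite mulrn_wge0// ltW.
exists (32 * pi / delta); first by rewrite divr_gt0// mulr_gt0.
move=> rho rho0.
(* Frequencies up to [y] keep all phases within [delta] at a visit. *)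
pose y := delta / (2 * pi * rho).
have y0 : 0 < y by rewrite divr_gt0// !mulr_gt0.
have rhoE : 32 * pi / delta * rho = 16 / y.
  by rewrite /y; move: (@pi R) pi0 => P P0; field; rewrite !gt_eqF.
(* For wide arcs the claimed bound exceeds [T], and nothing has to be counted. *)
have [y1|y1] := ltP y 1.
  exists 0%N => T N c _.
  apply: (@le_trans _ _ T%:R).
    rewrite -[in leRHS](card_ord T) -sum1_card natr_sum; apply: ler_sum => j _.
    by case: asboolP.
  rewrite ler_peMl// rhoE ler_pdivlMr//; lra.
pose K := Num.truncn y.
have K1 : (0 < K)%N by rewrite truncn_gt0.
have Ky : K%:R <= y by rewrite truncn_le// ltW.
have yK : y < 2 * K%:R.
  have := truncnS_gt y; rewrite -/K => yK1.
  apply: (lt_le_trans yK1); rewrite -natrM ler_nat; lia.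
have [T0 T0P] := fejer_mean_le K1 wx.
exists T0 => T N c TT; set S := \sum_(j < T) _.
have := T0P T N c TT; set F := \sum_(j < T) _ => FT.
have KS : K%:R ^+ 2 / 4 * S <= F.
  rewrite mulr_sumr; apply: ler_sum => j _.
  case: asboolP => [[m mP]|_]; last by rewrite mulr0 sqr_ge0.
  rewrite mulr1.
  have : K%:R / 2 <= \sum_(k < K) cos (pi *+ 2 * (k%:R * (x (N + j)%N - c))).
    have -> : K%:R / 2 = \sum_(k < K) (1 / 2) :> R.
      by rewrite sumr_const card_ord mul1r mulr_natl.
    apply: ler_sum => k _.
    have -> : pi *+ 2 * (k%:R * (x (N + j)%N - c)) =
        pi *+ 2 * (k%:R * (x (N + j)%N - c - m%:~R)) + pi *+ 2 * (k%:Z * m)%:~R.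
      by rewrite intrM; ring.
    rewrite cosD2pi_int; apply: cosP.
    rewrite !normrM normr_nat (ger0_norm pi20).
    apply: (@le_trans _ _ (pi *+ 2 * (y * rho))).
      apply: (ler_wpM2l pi20); apply: ler_pM => //.
      by apply: le_trans Ky; rewrite ler_nat ltnW.
    rewrite /y le_eqVlt; apply/orP; left; apply/eqP.
    by move: (@pi R) pi0 => P P0; field; rewrite !gt_eqF.
  have K2 : 0 <= K%:R / 2 :> R by rewrite divr_ge0.
  move=> h; have := lerXn2r 2 K2 (le_trans K2 h) h.
  by have -> : K%:R ^+ 2 / 4 = (K%:R / 2) ^+ 2 :> R by field.
have K0 : 0 < K%:R :> R by rewrite ltr0n.
have : K%:R * (K%:R * S) <= K%:R * (8 * T%:R) by move: KS FT; rewrite expr2; lra.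
rewrite ler_pM2l// => KS8.
rewrite rhoE mulrAC ler_pdivlMr//.
have S0 : 0 <= S by rewrite sumr_ge0.
have : S * y <= S * (2 * K%:R) by rewrite ler_wpM2l// ltW.
lra.
Qed.

Lemma poly_visit_frequency_le (R : realType) (p : {poly R}) :
  (exists i : nat, (1 <= i)%N /\ irrational p`_i) ->
  exists2 C0 : R, 0 < C0 & forall rho : R, 0 < rho -> exists T0, forall T N c, (T0 <= T)%N ->
    \sum_(j < T) (`[< near1 p.[(N + j)%:R] c rho >])%:R <= C0 * rho * T%:R.
Proof.
move=> [i [i1 ip]]; apply: (@visit_frequency_le _ (fun n => p.[n%:R])) => k k0.
have -> : (fun n => k%:R * p.[n%:R]) = (fun n => (k%:R *: p).[n%:R]).
  by apply/funext => n; rewrite hornerZ.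
apply: weyl_null_poly_irrational; exists i; split => //.
by rewrite coefZ mulrC; exact: irrational_mul_nat.
Qed.

(** * Words and binary expansions *)

(* A Kraft inequality: at a good position the words are cut after a block of
   [D n], at any other position after one letter, which costs a factor
   [2 b <= 4]. *)
Lemma parse_count (R : realType) (b : R) (M : nat) (W : seq (seq bool))
    (D : nat -> seq (seq bool)) (good : pred nat) :
  0 < b <= 2 -> uniq W -> (forall w, w \in W -> size w = M) ->
  (forall n u, u \in D n -> (0 < size u)%N) ->
  (forall n, good n -> \sum_(u <- D n) b ^+ size u <= 1) ->
  (forall n w, (n < M)%N -> good n -> w \in W ->
     exists2 u, u \in D n & exists v, drop n w = u ++ v) ->
  (size W)%:R * b ^+ M <= 4 ^+ (\sum_(0 <= n < M) ~~ good n).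
Proof.
move=> /andP[b0 b2] uW sW D0 D1 DW.
(* The distinct suffixes from position [n] are counted backwards from [M], where only the empty one
   is left. *)
pose S n := undup [seq drop n w | w <- W].
have memS n v : v \in S n -> exists2 w, w \in W & v = drop n w.
  by rewrite mem_undup => /mapP.
have Smem n w : w \in W -> drop n w \in S n.
  by move=> wW; rewrite mem_undup; exact: map_f.
suff main k n : (n <= M)%N -> (M - n <= k)%N ->
    (size (S n))%:R * b ^+ (M - n) <= 4 ^+ (\sum_(n <= i < M) ~~ good i).
  have := main M 0%N; rewrite subn0 => /(_ isT (leqnn _)).
  rewrite /S (_ : [seq drop 0 w | w <- W] = W) ?undup_id//.
  by under eq_map do rewrite drop0; rewrite map_id.
elim: k n => [|k IH] n nM kM.
  have -> : n = M by apply/eqP; rewrite eqn_leq nM -subn_eq0 -leqn0.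
  rewrite subnn expr0 mulr1 big_geq// expr0 lern1.
  apply: (@uniq_leq_size _ _ [:: [::]]); first exact: undup_uniq.
  by move=> v /memS[w /sW sw ->]; rewrite drop_oversize ?sw// inE.
move: nM; rewrite leq_eqVlt => /orP[/eqP nM|nM].
  by apply: IH; rewrite nM ?subnn.
rewrite big_ltn//; have [gn|bn] := boolP (good n); last first.
  have Sle : (size (S n) <= 2 * size (S n.+1))%N.
    rewrite mul2n -addnn -[X in (X + _)%N](size_map (cons true)).
    rewrite -[X in (_ + X)%N](size_map (cons false)) -size_cat.
    apply: uniq_leq_size; first exact: undup_uniq.
    move=> v /memS[w wW ->]; rewrite mem_cat (drop_nth true) ?sW//.
    by case: nth; rewrite map_f ?orbT// Smem.
  have h := IH n.+1 nM (ltac:(lia)).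
  rewrite /= exprS -(subnSK nM) exprS.
  apply: (@le_trans _ _ ((2 * b) * ((size (S n.+1))%:R * b ^+ (M - n.+1)))).
    have -> : 2 * b * ((size (S n.+1))%:R * b ^+ (M - n.+1)) =
      (2 * size (S n.+1))%:R * (b * b ^+ (M - n.+1)) by rewrite natrM; ring.
    by rewrite ler_wpM2r ?ler_nat// mulr_ge0 ?exprn_ge0// ltW.
  apply: ler_pM => //; first by rewrite mulr_ge0// ltW.
    by rewrite mulr_ge0// exprn_ge0// ltW.
  by lra.
rewrite add0n.
have Sle : (size (S n) <= \sum_(u <- D n | (n + size u <= M)%N) size (S (n + size u)%N))%N.
  have -> : (\sum_(u <- D n | (n + size u <= M)%N) size (S (n + size u)))%N =
     size (flatten [seq [seq u ++ v | v <- S (n + size u)%N] |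
        u <- D n & (n + size u <= M)%N]).
    rewrite size_flatten /shape -map_comp sumnE big_map big_filter.
    by apply: eq_bigr => u _ /=; rewrite size_map.
  apply: uniq_leq_size; first exact: undup_uniq.
  move=> v /memS[w wW ->]; have [u uD [v' uv]] := DW n w nM gn wW.
  have sz : (n + size u <= M)%N.
    have := congr1 size uv; rewrite size_drop size_cat (sW _ wW) => sz.
    by rewrite -(subnKC (ltnW nM)) leq_add2l sz leq_addr.
  apply/flattenP; exists [seq u ++ v | v <- S (n + size u)%N].
    by apply: map_f; rewrite mem_filter sz.
  rewrite uv; apply: map_f; have -> : v' = drop (n + size u) w.
    by rewrite addnC -drop_drop uv drop_size_cat.
  exact: Smem.
set E := 4 ^+ _.
have E0 : 0 <= E by rewrite exprn_ge0.
apply: (@le_trans _ _ (\sum_(u <- D n | (n + size u <= M)%N) b ^+ size u * E)).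
  apply: (@le_trans _ _
     (\sum_(u <- D n | (n + size u <= M)%N) (size (S (n + size u)%N))%:R * b ^+ (M - n))).
    by rewrite -mulr_suml -natr_sum ler_wpM2r ?ler_nat// exprn_ge0// ltW.
  rewrite big_seq_cond [leRHS]big_seq_cond; apply: ler_sum => u /andP[uD un].
  have splitM s : (n + s <= M -> M - n = s + (M - (n + s)))%N by lia.
  have ltk s : (0 < s -> M - (n + s) <= k)%N by move: nM kM; lia.
  rewrite (splitM _ un).
  rewrite exprD mulrCA ler_wpM2l ?exprn_ge0 ?(ltW b0)//.
  have u0 := D0 _ _ uD.
  apply: le_trans (IH _ un (ltk _ u0)) _.
  (* The block jumps over the positions before [n + size u]; restoring their factors 4 only weakens
     the bound. *)
  rewrite /E (@big_cat_nat _ _ _ (n + size u) n.+1 M)//=; last by rewrite -addn1 leq_add2l.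
  by rewrite exprD ler_peMl ?exprn_ge0// exprn_ege1// ler1n.
rewrite -mulr_suml -[leRHS]mul1r ler_wpM2r//.
apply: le_trans (D1 n gn); rewrite big_mkcond/=; apply: ler_sum => u _.
by case: ifP => // _; rewrite exprn_ge0// ltW.
Qed.

(** Fekete's argument: [lambda] is the exponential of the infimum of ln(u m) / m, and the slack
    [theta] allows a single [m] nearly attaining it. Division of [l] by that [m] leaves a remainder
    absorbed in [C]. *)
Lemma submultiplicative_growth (R : realType) (u : nat -> nat) (theta : R) :
  (forall l, (0 < u l)%N) -> (forall k l, (u (k + l) <= u k * u l)%N) -> 1 < theta ->
  exists lambda C : R, [/\ 1 <= lambda, 0 < C, forall M, lambda ^+ M <= (u M)%:R &
    forall l, (u l)%:R <= C * (lambda * theta) ^+ l].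
Proof.
move=> u0 uM th1.
have th0 : 0 < theta by apply: lt_trans th1.
have uR l : 1 <= (u l)%:R :> R by rewrite ler1n.
have uR0 l : 0 < (u l)%:R :> R by rewrite ltr0n.
pose B : set R := [set ln ((u m.+1)%:R) / m.+1%:R | m in [set: nat]].
have B0 : B !=set0 by exists (ln ((u 1)%:R) / 1); exists 0%N.
have lB : lbound B 0 by move=> _ [m _ <-]; rewrite divr_ge0// ln_ge0.
have hB : has_inf B by split => //; exists 0.
have [_ [m _ <-] mP] := inf_adherent (ln_gt0 th1) hB.
have inf0 : 0 <= inf B by apply: lb_le_inf.
pose lambda := expR (inf B).
have l1 : 1 <= lambda by rewrite -expR0 ler_expR.
have lth1 : 1 <= lambda * theta by rewrite -[1]mulr1 ler_pM// ltW.
have um : (u m.+1)%:R <= (lambda * theta) ^+ m.+1.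
  have -> : lambda * theta = expR (inf B + ln theta) by rewrite expRD lnK.
  rewrite -expRM_natl -[leLHS]lnK ?posrE// ler_expR mulrC.
  by rewrite -ler_pdivrMr ?ltr0n// ltW// mP.
exists lambda, (\sum_(r < m.+1) (u r)%:R); split=> //.
- by rewrite big_ord_recl ltr_pwDl// sumr_ge0.
- move=> [|M]; first by rewrite expr0.
  rewrite -expRM_natl -[leRHS]lnK ?posrE// ler_expR mulrC.
  rewrite -ler_pdivlMr ?ltr0n//; apply: (ge_inf (proj2 hB)); by exists M.
move=> l; rewrite {1}(divn_eq l m.+1).
have ltm : (l %% m.+1 < m.+1)%N by rewrite ltn_mod.
apply: (@le_trans _ _ ((u m.+1)%:R ^+ (l %/ m.+1)%N * (u (l %% m.+1)%N)%:R)).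
  rewrite -natrX -natrM ler_nat.
  elim: (l %/ m.+1)%N => [|q IH]; first by rewrite mul0n expn0 mul1n.
  rewrite mulSn -addnA (leq_trans (uM _ _))// expnS -mulnA leq_mul2l.
  by rewrite IH orbT.
rewrite -[leLHS]mulrC; apply: ler_pM => //.
  rewrite (bigD1 (Ordinal ltm))//= lerDl; exact: sumr_ge0.
apply: (@le_trans _ _ ((lambda * theta) ^+ m.+1 ^+ (l %/ m.+1)%N)).
  by rewrite lerXn2r ?nnegrE// exprn_ge0// (le_trans ler01).
rewrite -exprM mulnC ler_weXn2l//; exact: leq_trunc_div.
Qed.

Definition factor (e : nat -> bool) (n l : nat) : seq bool := map e (iota n l).

(** The list has no repetition, so its [size] is the complexity function of the sequence [e]
    restricted to indices at least 1. *)
Definition language (e : nat -> bool) (l : nat) : seq (seq bool) :=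
  [seq val t | t <- enum {: l.-tuple bool} &
     `[< exists2 n, (1 <= n)%N & val t = factor e n l >]].

Lemma languageP (e : nat -> bool) (l : nat) (w : seq bool) :
  reflect (exists2 n, (1 <= n)%N & w = factor e n l) (w \in language e l).
Proof.
apply: (iffP mapP) => [[t + ->]|[n n1 ->]].
  by rewrite mem_filter => /andP[/asboolP].
have sz : size (factor e n l) == l by rewrite size_map size_iota.
exists (Tuple sz) => //; rewrite mem_filter mem_enum andbT.
by apply/asboolP; exists n.
Qed.

Lemma uniq_language e l : uniq (language e l).
Proof. by rewrite map_inj_uniq; [rewrite filter_uniq// enum_uniq|exact: val_inj]. Qed.

Lemma size_language_gt0 e l : (0 < size (language e l))%N.
Proof.
rewrite lt0n size_eq0; apply/eqP => l0.
have : factor e 1 l \in language e l by apply/languageP; exists 1%N.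
by rewrite l0.
Qed.

Lemma size_in_language e l w : w \in language e l -> size w = l.
Proof. by move=> /languageP[n _ ->]; rewrite size_map size_iota. Qed.

Lemma factorD e n k l : factor e n (k + l) = factor e n k ++ factor e (n + k) l.
Proof. by rewrite /factor iotaD map_cat. Qed.

Lemma size_languageD e k l :
  (size (language e (k + l)) <= size (language e k) * size (language e l))%N.
Proof.
rewrite -(size_allpairs cat); apply: uniq_leq_size; first exact: uniq_language.
move=> w /languageP[n n1 ->]; rewrite factorD.
apply/allpairsP; exists (factor e n k, factor e (n + k) l); split => //=.
  by apply/languageP; exists n.
by apply/languageP; exists (n + k)%N => //; rewrite (leq_trans n1)// leq_addr.
Qed.

Fixpoint binary_value (R : realType) (w : seq bool) : R :=
  if w is b :: w' then (b%:R + binary_value R w') / 2 else 0.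

Lemma mod1_bounds (R : realType) (x : R) : 0 <= mod1 x < 1.
Proof.
rewrite /mod1 subr_ge0 floor_le_tmp/= ltrBlDr addrC.
by have := floorD1_gt x; rewrite intrD.
Qed.

Lemma mod1_eq (R : realType) (x f : R) (m : int) : x = m%:~R + f -> 0 <= f < 1 -> mod1 x = f.
Proof.
move=> -> /andP[f0 f1]; rewrite /mod1.
have -> : Num.floor (m%:~R + f) = m; last by rewrite addrC addKr.
by apply: floor_def; rewrite lerDl f0 intrD ltrD2l.
Qed.

Lemma mod1_near (R : realType) (x : R) : exists m : int, mod1 x = x - m%:~R.
Proof. by exists (Num.floor x). Qed.

(** Indexing starts at 0: [digit d 0] is the first binary digit of [d] after the point. *)
Definition digit (R : realType) (d : R) (n : nat) : bool := 1 / 2 <= mod1 (2 ^+ n * d).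

Lemma mod1_double (R : realType) (d : R) (n : nat) :
  mod1 (2 ^+ n * d) = ((digit d n)%:R + mod1 (2 ^+ n.+1 * d)) / 2.
Proof.
have [m mE] := mod1_near (2 ^+ n * d); have /andP[m0 m1] := mod1_bounds (2 ^+ n * d).
have -> : mod1 (2 ^+ n.+1 * d) = 2 * mod1 (2 ^+ n * d) - (digit d n)%:R.
  apply: (@mod1_eq _ _ _ (2 * m + (digit d n)%:Z)).
    by rewrite mE exprS intrD intrM -pmulrn; ring.
  by rewrite /digit; case: (leP (1 / 2)) => /= h; apply/andP; rewrite ?mulr1n ?mulr0n; split; lra.
by field.
Qed.

(** The remainder after [l] digits is 2^-l times the fractional part of 2^(n + l) d. *)
Lemma binary_expansion (R : realType) (d : R) (l n : nat) :
  exists2 m : int, 0 <= 2 ^+ n * d - binary_value R (factor (digit d) n l) - m%:~R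
   & 2 ^+ n * d - binary_value R (factor (digit d) n l) - m%:~R <= 2 ^- l.
Proof.
have [m mE] := mod1_near (2 ^+ n * d).
suff E : mod1 (2 ^+ n * d) =
    binary_value R (factor (digit d) n l) + 2 ^- l * mod1 (2 ^+ (n + l) * d).
  have /andP[m0 m1] := mod1_bounds (2 ^+ (n + l) * d).
  exists m.
    have : 0 <= 2 ^- l * mod1 (2 ^+ (n + l) * d) by rewrite mulr_ge0// invr_ge0 exprn_ge0.
    by lra.
  have : 2 ^- l * mod1 (2 ^+ (n + l) * d) <= 2 ^- l.
    by rewrite ler_piMr ?(ltW m1)// invr_ge0 exprn_ge0.
  by lra.
elim: l n {m mE} => [|l IH] n; first by rewrite addn0 expr0 invr1 mul1r add0r.
rewrite mod1_double /= IH -/(factor _ _ _) addSnnS exprS.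
by field; rewrite expf_neq0.
Qed.

(** * Polynomially many classes of trajectories *)

Lemma poly_lt_expn (K s n0 : nat) : exists2 m, (n0 <= m)%N & (K * m ^ s < 2 ^ m)%N.
Proof.
(* At m = 2^k the claim follows from K + k s <= k^2 <= 2^k. *)
pose k := (K + s + n0 + 4)%N.
have kk : (k <= 2 ^ k)%N by rewrite ltnW// ltn_expl.
exists (2 ^ k)%N; first by rewrite (leq_trans _ kk)// /k; lia.
apply: (@leq_trans (2 ^ (K + k * s))).
  by rewrite expnD -expnM ltn_pmul2r ?expn_gt0// ltn_expl.
rewrite leq_exp2l//.
have : (k ^ 2 <= 2 ^ k)%N.
  have : (4 <= k)%N by rewrite /k; lia.
  elim: (k) => // j IH; rewrite leq_eqVlt => /orP[/eqP <-//|].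
  rewrite ltnS => j4; have := IH j4; rewrite (expnS 2).
  have : (j.+1 ^ 2 <= 2 * j ^ 2)%N by rewrite !expnS !expn0; nia.
  lia.
rewrite !expnS expn0; have : (K + s < k)%N by rewrite /k; lia.
nia.
Qed.

(* Windows with the same key see nearly the same values of [p] mod 1, and there
   are only polynomially many keys. *)
Definition taylor_key (R : realType) (p : {poly R}) (Q N : nat) :
    {ffun 'I_(size p) -> 'I_Q.+1} :=
  [ffun m : 'I_(size p) => inord (Num.truncn (Q%:R * mod1 p^`N(m).[N%:R]))].

(** Equal keys put the Taylor coefficients at [N] and [N'] within 1 / [Q] of each other modulo 1.
    Each such error is multiplied by a power of [j], and the integer parts stay integers. *)
Lemma taylor_key_near (R : realType) (p : {poly R}) (Q M N N' j : nat) :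
  (0 < Q)%N -> (j < M)%N -> taylor_key p Q N = taylor_key p Q N' ->
  near1 p.[(N + j)%:R] p.[(N' + j)%:R] ((size p * M ^ size p)%:R / Q%:R).
Proof.
move=> Q0 jM /ffunP keyE.
have QR : 0 < Q%:R :> R by rewrite ltr0n.
have coefE (m : 'I_(size p)) : exists z : int,
    `|p^`N(m).[N%:R] - p^`N(m).[N'%:R] - z%:~R| <= Q%:R^-1.
  have := keyE m; rewrite !ffunE => /(congr1 val).
  set x := p^`N(m).[N%:R]; set y := p^`N(m).[N'%:R].
  have /andP[x0 x1] := mod1_bounds x; have /andP[y0 y1] := mod1_bounds y.
  have lt (u : R) : 0 <= u < 1 -> (Num.truncn (Q%:R * u) < Q.+1)%N.
    move=> /andP[u0 u1]; rewrite ltnS -(ler_nat R).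
    apply: (@le_trans _ _ (Q%:R * u)); first by rewrite truncn_le// mulr_ge0.
    by rewrite ler_piMr// ltW.
  rewrite /= !inordK ?lt ?mod1_bounds// => e.
  have [mx mxE] := mod1_near x; have [my myE] := mod1_near y.
  exists (mx - my); rewrite intrB.
  have -> : x - y - (mx%:~R - my%:~R) = mod1 x - mod1 y by rewrite mxE myE; ring.
  rewrite -(ler_pM2l QR) divff ?gt_eqF// -[X in X * `|_|]ger0_norm ?ler0n// -normrM mulrBr.
  have /truncn_itv/andP[] : 0 <= Q%:R * mod1 x by rewrite mulr_ge0.
  have /truncn_itv/andP[] : 0 <= Q%:R * mod1 y by rewrite mulr_ge0.
  rewrite e -natr1 ler_norml; lra.
rewrite !natrD !nderiv_taylor; try exact: mulrC.
have /choice[z zP] := coefE.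
exists (\sum_(m < size p) z m * (j ^ m)%N%:Z).
have -> : \sum_(i < size p) p^`N(i).[N%:R] * j%:R ^+ i -
    \sum_(i < size p) p^`N(i).[N'%:R] * j%:R ^+ i -
    (\sum_(m < size p) z m * (j ^ m)%N%:Z)%:~R =
  \sum_(i < size p) (p^`N(i).[N%:R] - p^`N(i).[N'%:R] - (z i)%:~R) * j%:R ^+ i.
  rewrite rmorph_sum/= -!sumrB; apply: eq_bigr => i _.
  by rewrite intrM -pmulrn natrX; ring.
apply: (le_trans (ler_norm_sum _ _ _)).
have -> : (size p * M ^ size p)%:R / Q%:R = \sum_(i < size p) (Q%:R^-1 * (M ^ size p)%:R) :> R.
  by rewrite sumr_const card_ord natrM -[RHS]mulr_natl; ring.
apply: ler_sum => i _; rewrite normrM ler_pM//.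
rewrite ger0_norm ?exprn_ge0// -natrX ler_nat.
apply: (@leq_trans (M ^ i)); first by case: (nat_of_ord i) => // k; rewrite leq_exp2r// ltnW.
rewrite leq_pexp2l//; first by rewrite (leq_ltn_trans _ jM).
exact: ltnW.
Qed.

Lemma size_fibers (T : eqType) (K : finType) (s : seq T) (key : T -> K) :
  (size s = \sum_(k : K) size [seq x <- s | key x == k])%N.
Proof.
elim: s => [|x s IH]; first by rewrite big1.
rewrite (eq_bigr (fun k => (key x == k) + size [seq y <- s | key y == k])%N).
  rewrite big_split/= -IH (bigD1 (key x))//= eqxx big1 ?addn0// => k.
  by rewrite eq_sym => /negPf ->.
by move=> k _ /=; case: eqP.
Qed.

Lemma exists_expr_ge (R : realType) (mu A : R) : 1 < mu -> exists2 D : nat, (0 < D)%N & A <= mu ^+ D.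
Proof.
move=> mu1; exists (Num.truncn (A / (mu - 1))).+1 => //.
set D := _.+1.
have m0 : 0 < mu - 1 by rewrite subr_gt0.
have AD : A <= D%:R * (mu - 1) by rewrite -ler_pdivrMr// ltW// truncnS_gt.
apply: (le_trans AD).
(* A form of Bernoulli's inequality. *)
elim: (D) => [|k IH]; first by rewrite mul0r expr0.
rewrite exprS -natr1 mulrDl mul1r.
have : 1 <= mu ^+ k by rewrite exprn_ege1// ltW.
nra.
Qed.

(** * The covering argument *)

Section Cover.
Variables (R : realType) (p : {poly R}) (d : R) (I : seq (R * nat)).

(** A pair in [I] is a centre with a radius exponent. The factor 3 adds up three errors of at most
    2^-l: the radius of the cover element, the truncation of the binary expansion, and the
    replacement of the actual trajectory by the one starting at [N]. *)
Definition cover_words (N n : nat) : seq (seq bool) :=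
  flatten [seq [seq u <- language (digit d) i.2 |
      `[< near1 p.[(N + n)%:R] (i.1 - binary_value R u) (3 * 2 ^- i.2) >] ] | i <- I].

Lemma cover_wordsP N n u : reflect (exists2 i, i \in I & u \in language (digit d) i.2 /\
    near1 p.[(N + n)%:R] (i.1 - binary_value R u) (3 * 2 ^- i.2))
  (u \in cover_words N n).
Proof.
apply: (iffP flattenP) => [[_ /mapP[i iI ->]]|[i iI [ul un]]].
  by rewrite mem_filter => /andP[/asboolP un ul]; exists i.
by eexists; [exact: map_f iI|rewrite mem_filter ul andbT; apply/asboolP].
Qed.

Lemma cover_words_weight (b : R) N n : \sum_(u <- cover_words N n) b ^+ size u =
  \sum_(i <- I) \sum_(u <- language (digit d) i.2)
    b ^+ i.2 * (`[< near1 p.[(N + n)%:R] (i.1 - binary_value R u) (3 * 2 ^- i.2) >])%:R.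
Proof.
rewrite big_flatten/= big_map; apply: eq_bigr => i _.
rewrite big_filter big_mkcond/= [LHS]big_seq [RHS]big_seq.
apply: eq_bigr => u /size_in_language ->.
by case: asboolP; rewrite ?mulr1 ?mulr0.
Qed.

(** After exchanging the sums, each pair of a cover element and a word contributes the number of
    visits of the polynomial to one fixed arc. *)
Lemma sum_cover_words_weight_le (b C0 : R) : 0 <= b ->
  (forall rho : R, 0 < rho -> exists T0, forall T N c, (T0 <= T)%N ->
    \sum_(j < T) (`[< near1 p.[(N + j)%:R] c rho >])%:R <= C0 * rho * T%:R) ->
  exists T0, forall T N, (T0 <= T)%N ->
    \sum_(n < T) \sum_(u <- cover_words N n) b ^+ size u <=
    \sum_(i <- I) (size (language (digit d) i.2))%:R * b ^+ i.2 * (C0 * (3 * 2 ^- i.2) * T%:R).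
Proof.
move=> b0 freq.
have /choice[f fP] : forall l : nat, exists T0, forall T N c, (T0 <= T)%N ->
    \sum_(j < T) (`[< near1 p.[(N + j)%:R] c (3 * 2 ^- l) >])%:R <=
      C0 * (3 * 2 ^- l) * T%:R.
  by move=> l; apply: freq; rewrite mulr_gt0// invr_gt0 exprn_gt0.
exists (\max_(i <- I) f i.2)%N => T N TT.
under eq_bigr do rewrite cover_words_weight.
rewrite exchange_big/= [leLHS]big_seq [leRHS]big_seq; apply: ler_sum => i iI.
rewrite exchange_big/=.
have -> : (size (language (digit d) i.2))%:R * b ^+ i.2 * (C0 * (3 * 2 ^- i.2) * T%:R) =
    \sum_(u <- language (digit d) i.2) b ^+ i.2 * (C0 * (3 * 2 ^- i.2) * T%:R).
  by rewrite big_const_seq count_predT iter_addr_0 -mulr_natl; ring.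
apply: ler_sum => u _; rewrite -mulr_sumr ler_wpM2l ?exprn_ge0//.
apply: fP; apply: leq_trans TT.
exact: (@leq_bigmax_seq _ _ predT (fun i : R * nat => f i.2) i iI isT).
Qed.

Hypothesis coverI : forall n, (1 <= n)%N ->
  exists2 i, i \in I & near1 (p.[n%:R] + 2 ^+ n * d) i.1 (2 ^- i.2).

(** All words in [W] occur along trajectories close to that of [N0], so they share the block lists
    of [cover_words] and [parse_count] applies. By Markov's inequality at most [B] positions have
    weight above 1; at most [L] more are too close to the end of the window for a whole block to
    fit. *)
Lemma fiber_count (b : R) (L M B N0 : nat) (W : seq (seq bool)) :
  0 < b <= 2 -> (forall i, i \in I -> (0 < i.2 <= L)%N) -> uniq W ->
  (forall w, w \in W -> exists N, [/\ (1 <= N)%N, w = factor (digit d) N M &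
     forall j, (j < M)%N -> near1 p.[(N + j)%:R] p.[(N0 + j)%:R] (2 ^- L)]) ->
  \sum_(n < M) \sum_(u <- cover_words N0 n) b ^+ size u <= B%:R ->
  (size W)%:R * b ^+ M <= 4 ^+ (B + L).
Proof.
move=> b02 IL uW WP SB; have /andP[b0 b2] := b02.
pose good n := (\sum_(u <- cover_words N0 n) b ^+ size u <= 1) && (n + L <= M)%N.
apply: (@le_trans _ _ (4 ^+ (\sum_(0 <= n < M) ~~ good n))).
  apply: (@parse_count _ _ _ _ (cover_words N0)) => //.
  - by move=> w /WP[N [_ -> _]]; rewrite size_map size_iota.
  - by move=> n u /cover_wordsP[i /IL/andP[i0 _] [/size_in_language -> _]].
  - by move=> n /andP[].
  move=> n w nM /andP[_ nL] /WP[N [N1 wE nearN]].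
  have [i iI [z zP]] := coverI (leq_trans N1 (leq_addr n N)).
  have /andP[_ iL] := IL i iI.
  have [m m0 m1] := binary_expansion d i.2 (N + n).
  have [y yP] := nearN n nM.
  have LE : 2 ^- L <= 2 ^- i.2 :> R.
    by rewrite lef_pV2 ?posrE ?exprn_gt0// ler_weXn2l// ler1n.
  exists (factor (digit d) (N + n) i.2).
    apply/cover_wordsP; exists i => //; split.
      by apply/languageP; exists (N + n)%N => //; rewrite (leq_trans N1)// leq_addr.
    exists (z - m - y); rewrite !intrB.
    move: zP yP; rewrite !ler_norml => /andP[z1 z2] /andP[y1 y2].
    by apply/andP; split; lra.
  exists (factor (digit d) (N + n + i.2) (M - n - i.2)).
  rewrite -factorD subnKC; last first.
    by rewrite leq_subRL ?(ltnW nM)// (leq_trans _ nL)// leq_add2l.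
  by rewrite wE /factor -map_drop drop_iota addnC.
rewrite ler_weXn2l ?ler1n// -(ler_nat R) natr_sum natrD big_mkord.
apply: (@le_trans _ _ (\sum_(n < M) (\sum_(u <- cover_words N0 n) b ^+ size u
   + (M < n + L)%N%:R))).
  apply: ler_sum => n _; rewrite /good negb_and -ltNge -ltnNge.
  have S0 : 0 <= \sum_(u <- cover_words N0 n) b ^+ size u.
    by rewrite sumr_ge0// => u _; rewrite exprn_ge0// ltW.
  case: ltP => /= [h|_]; last by rewrite lerDr.
  by rewrite (le_trans (ltW h))// lerDl.
rewrite big_split/= lerD// -natr_sum ler_nat.
have cnt m : (\sum_(n < m) (n < L) = minn m L)%N.
  elim: m => [|m IH]; first by rewrite big_ord0 min0n.
  by rewrite big_ord_recr/= IH; case: ltnP; lia.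
(* Read from the right, the positions near the end are those of index below [L]. *)
rewrite (reindex_inj rev_ord_inj)/=.
apply: (@leq_trans (\sum_(n < M) (n < L))%N); last by rewrite cnt geq_minr.
apply: leq_sum => n _; have := ltn_ord n; case: ltnP => // + nM.
by case: ltnP => //; move: nM; lia.
Qed.

End Cover.

(** Intervals of different lengths are allowed, as Hausdorff dimension requires. For [a] = 2^-s with
    s < 1 the sum is an s-dimensional content, so this one statement serves both lower bounds. *)
Lemma no_thin_cover (R : realType) (p : {poly R}) (d a : R) :
  (exists i : nat, (1 <= i)%N /\ irrational p`_i) -> 1 / 2 < a < 1 ->
  exists2 kappa : R, 0 < kappa & forall I : seq (R * nat),
    \sum_(i <- I) a ^+ i.2 <= kappa ->
    ~ (forall n, (1 <= n)%N ->
        exists2 i, i \in I & near1 (p.[n%:R] + 2 ^+ n * d) i.1 (2 ^- i.2)).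
Proof.
move=> hp /andP[a2 a1]; have a0 : 0 < a by lra.
have [C0 C00 freq] := poly_visit_frequency_le hp.
pose lang l := language (digit d) l.
have [theta [th1 th2]] : exists theta, 1 < theta /\ theta < 2 * a.
  by exists ((1 + 2 * a) / 2); split; lra.
have [lambda [C [l1 C1 lle ule]]] := submultiplicative_growth
  (size_language_gt0 (digit d)) (size_languageD (digit d)) th1.
have l0 : 0 < lambda by apply: lt_le_trans l1.
have th0 : 0 < theta by apply: lt_trans th1.
(* the weight [b] makes [lambda * theta * b / 2 = a] and [lambda * b > 1] *)
pose b := 2 * a / (lambda * theta).
have b0 : 0 < b by rewrite /b divr_gt0// mulr_gt0.
have b2 : b <= 2.
  rewrite /b ler_pdivrMr ?mulr_gt0//.
  have : 1 <= lambda * theta by rewrite -[1]mulr1 ler_pM// ltW.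
  lra.
have mu1 : 1 < lambda * b.
  have -> : lambda * b = 2 * a / theta by rewrite /b; field; rewrite !gt_eqF.
  by rewrite ltr_pdivlMr// mul1r.
(* Each stretch of [D] letters gains a factor 8, against a factor 4 for each bad position, of which
   there will be about one in [D]. *)
have [D D0 D8] := exists_expr_ge 8 mu1.
have DR : 0 < D%:R :> R by rewrite ltr0n.
(* The bound 1/2 excludes the exponent 0, since [a ^+ 0 = 1]; the other bound makes the mean weight
   per position at most 1 / [D]. *)
exists (Num.min (1 / 2) (3 * C0 * C * D%:R)^-1).
  by rewrite lt_min invr_gt0 !mulr_gt0// andbT; lra.
move=> I; rewrite le_min => /andP[sum2 sumD] cover.
have Ipos i : i \in I -> (0 < i.2)%N.
  move=> iI; rewrite lt0n; apply/eqP => i0.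
  have : a ^+ i.2 <= \sum_(i <- I) a ^+ i.2.
    by rewrite (big_rem i)//= lerDl sumr_ge0// => k _; rewrite exprn_ge0// ltW.
  by rewrite i0 expr0; lra.
pose L := (\max_(i <- I) i.2)%N.
have IL i : i \in I -> (0 < i.2 <= L)%N.
  move=> iI; rewrite Ipos//= /L.
  exact: (@leq_bigmax_seq _ _ predT (fun i : R * nat => i.2) i iI isT).
have [T0 T0P] := sum_cover_words_weight_le d I (ltW b0) freq.
pose s := size p.
(* [M'] is so large that the number of keys times 4^L is less than 2^M'. *)
have [M' M'T M'big] := poly_lt_expn
  ((2 * s.+1 * D ^ s * 2 ^ L) ^ s * 4 ^ L) (s * s) (T0 + 1).
pose M := (D * M')%N.
have M'0 : (0 < M')%N by apply: leq_trans M'T; rewrite addn1.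
have MM' : (M' <= M)%N by rewrite leq_pmull.
have MT : (T0 <= M)%N by rewrite (leq_trans _ MM')// (leq_trans _ M'T)// leq_addr.
have M0 : (0 < M)%N by rewrite (leq_trans M'0).
(* This resolution brings the error of [taylor_key_near] below 2^-L. *)
pose Q := (s.+1 * M ^ s * 2 ^ L)%N.
have Q0 : (0 < Q)%N by rewrite !muln_gt0 !expn_gt0 M0.
have weight N : \sum_(n < M) \sum_(u <- cover_words p d I N n) b ^+ size u <= M'%:R.
  apply: (le_trans (T0P M N MT)).
  apply: (@le_trans _ _ (\sum_(i <- I) 3 * C0 * C * M%:R * a ^+ i.2)).
    apply: ler_sum => i _.
    have -> : a ^+ i.2 = (lambda * theta) ^+ i.2 * b ^+ i.2 * 2 ^- i.2.
      rewrite -exprMn -exprVn -exprMn; congr (_ ^+ _).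
      by rewrite /b; field; rewrite !gt_eqF.
    have -> : (size (language (digit d) i.2))%:R * b ^+ i.2 * (C0 * (3 * 2 ^- i.2) * M%:R) =
      (b ^+ i.2 * (C0 * (3 * 2 ^- i.2) * M%:R)) * (size (language (digit d) i.2))%:R by ring.
    have -> : 3 * C0 * C * M%:R * ((lambda * theta) ^+ i.2 * b ^+ i.2 * 2 ^- i.2) =
      (b ^+ i.2 * (C0 * (3 * 2 ^- i.2) * M%:R)) * (C * (lambda * theta) ^+ i.2) by ring.
    apply: ler_wpM2l => //.
    by rewrite !mulr_ge0 ?exprn_ge0 ?invr_ge0 ?exprn_ge0// ltW.
  rewrite -mulr_sumr /M natrM.
  have P0 : 0 < 3 * C0 * C * D%:R by rewrite !mulr_gt0.
  move: sumD; rewrite -[leRHS]mul1r (ler_pdivlMr _ _ P0) mulrC => sumD.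
  have -> : 3 * C0 * C * (D%:R * M'%:R) * \sum_(i <- I) a ^+ i.2 =
    M'%:R * (3 * C0 * C * D%:R * \sum_(i <- I) a ^+ i.2) by ring.
  by rewrite ler_piMr.
(* One occurrence is fixed for each word, and words are sorted by the key there. *)
have /choice[N NP] : forall w, exists N, w \in lang M ->
    (1 <= N)%N /\ w = factor (digit d) N M.
  move=> w; have [/languageP[N N1 wE]|wn] := boolP (w \in lang M).
    by exists N.
  by exists 0%N.
have fib k : (size [seq w <- lang M | taylor_key p Q (N w) == k])%:R * b ^+ M
    <= 4 ^+ (M' + L) :> R.
  case E : [seq w <- lang M | taylor_key p Q (N w) == k] => [|w0 W].
    by rewrite mul0r exprn_ge0.
  rewrite -E.
  have : w0 \in [seq w <- lang M | taylor_key p Q (N w) == k] by rewrite E inE eqxx.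
  rewrite mem_filter => /andP[/eqP kw0 _].
  apply: (@fiber_count _ p d I cover b L M M' (N w0)) => //.
  - by rewrite b0.
  - by rewrite filter_uniq// uniq_language.
  move=> w; rewrite mem_filter => /andP[/eqP kw wl].
  have [N1 wE] := NP _ wl; exists (N w); split => // j jM.
  have [z zP] := taylor_key_near Q0 jM (etrans kw (esym kw0)).
  exists z; apply: (le_trans zP).
  rewrite ler_pdivrMr ?ltr0n// -/s /Q [in leRHS]natrM natrX mulrCA mulVf ?mulr1; last first.
    by rewrite expf_neq0.
  by rewrite ler_nat leq_mul2r leqnSn orbT.
have total : (lambda * b) ^+ M <= ((Q.+1 ^ s) * 4 ^ (M' + L))%N%:R.
  rewrite exprMn.
  apply: (@le_trans _ _ ((size (lang M))%:R * b ^+ M)).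
    by rewrite ler_wpM2r// exprn_ge0// ltW.
  rewrite (size_fibers _ (fun w => taylor_key p Q (N w))) natr_sum mulr_suml.
  apply: (le_trans (ler_sum _ (fun k _ => fib k))).
  by rewrite sumr_const card_ffun !card_ord -[leLHS]mulr_natl natrM !natrX.
have big : (8 ^ M' <= Q.+1 ^ s * 4 ^ (M' + L))%N.
  rewrite -(ler_nat R); apply: le_trans total.
  have lb0 : 0 <= lambda * b by rewrite mulr_ge0// ltW.
  by rewrite /M exprM natrX lerXn2r ?nnegrE ?exprn_ge0.
have Qle : (Q.+1 <= 2 * s.+1 * D ^ s * 2 ^ L * M' ^ s)%N.
  apply: (@leq_trans (2 * Q)); first by rewrite mul2n -addnn -addn1 leq_add2l.
  rewrite /Q /M expnMn; move: s.+1 (D ^ s)%N (M' ^ s)%N (2 ^ L)%N => t x y z.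
  by rewrite (_ : 2 * (t * (x * y) * z) = 2 * t * x * z * y)%N//; ring.
(* Writing 8 = 2 * 4 and cancelling 4^M' contradicts the choice of [M']. *)
have : (2 ^ M' * 4 ^ M' <= ((2 * s.+1 * D ^ s * 2 ^ L) ^ s * 4 ^ L * M' ^ (s * s)) * 4 ^ M')%N.
  rewrite -expnMn; apply: (leq_trans big).
  apply: (@leq_trans ((2 * s.+1 * D ^ s * 2 ^ L * M' ^ s) ^ s * 4 ^ (M' + L))).
    rewrite leq_mul2r; case: (s) Qle => [|k] Qle; rewrite ?expn0 ?leqnn ?orbT//.
    by rewrite leq_exp2r ?Qle ?orbT.
  rewrite expnMn -expnM expnD.
  move: (_ ^ s)%N (M' ^ _)%N (4 ^ L)%N (4 ^ M')%N => t x y z.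
  by rewrite (_ : t * x * (z * y) = t * y * x * z)%N//; ring.
rewrite leq_pmul2r ?expn_gt0// leqNgt.
by rewrite M'big.
Qed.

(** * Hausdorff and box dimensions *)

Lemma powR_le1_antitone (R : realType) (x y z : R) : 0 < x <= 1 -> y <= z -> x `^ z <= x `^ y.
Proof.
move=> /andP[x0 x1] yz; rewrite /powR gt_eqF// ler_expR.
by rewrite ler_wnM2r// ln_le0.
Qed.

Lemma dyadic_scale (R : realType) (x : R) : 0 < x < 1 ->
  exists l : nat, x < 2 ^- l <= 2 * x.
Proof.
move=> /andP[x0 x1].
have [k _ kP] := @exists_expr_ge R 2 x^-1 (ltac:(lra)).
have exP : exists k : nat, x^-1 <= 2 ^+ k by exists k.
case: (ex_minnP exP) => m mP mmin.
case: m mP mmin => [|m] mP mmin.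
  by move: mP; rewrite expr0 invf_le1//; lra.
have mlt : 2 ^+ m < x^-1 by rewrite ltNge; apply/negP => /mmin; rewrite ltnn.
exists m; apply/andP; split.
  by rewrite -[x]invrK ltf_pV2// ?posrE ?invr_gt0// exprn_gt0.
rewrite -ler_pdivrMl// mulrC -invfM -exprSr -[leRHS]invrK lef_pV2// ?posrE ?invr_gt0// exprn_gt0.
Qed.

(** Translates a power of a diameter into the weight used by [no_thin_cover]; the factor 2 bounds
    2^s. *)
Lemma scale_powR_le (R : realType) (x s : R) (l : nat) :
  0 < x -> 0 <= s <= 1 -> 2 ^- l <= 2 * x -> (2 `^ (- s)) ^+ l <= 2 * x `^ s.
Proof.
move=> x0 /andP[s0 s1] lx.
have -> : (2 `^ (- s)) ^+ l = (2 ^- l) `^ s :> R.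
  rewrite -powR_mulrn ?powR_ge0// -powRrM mulrC mulrN -mulNr powRrM.
  by rewrite powRN powR_mulrn.
apply: (@le_trans _ _ ((2 * x) `^ s)).
  by apply: ge0_ler_powR; rewrite ?nnegrE ?invr_ge0 ?exprn_ge0// ltW// mulr_gt0.
rewrite powRM ?(ltW x0)// ler_wpM2r ?powR_ge0//.
by apply: ler1_powR => //; rewrite ler1n.
Qed.

Lemma contraction_base (R : realType) (s : R) : 0 < s < 1 -> 1 / 2 < (2 : R) `^ (- s) < 1.
Proof.
move=> /andP[s0 s1].
have l2 : 0 < ln 2 :> R by rewrite ln_gt0// ltr1n.
have -> : 1 / 2 = 2 `^ (-1) :> R by rewrite powR_inv1// mul1r.
rewrite /powR pnatr_eq0/=; apply/andP; split.
  by rewrite ltr_expR ltr_pM2r// ltrN2.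
by rewrite expR_lt1 pmulr_llt0// oppr_lt0.
Qed.

Lemma exists_expr_le (R : realType) (r e : R) : 0 < r < 1 -> 0 < e ->
  exists l0 : nat, forall l, (l0 <= l)%N -> r ^+ l <= e.
Proof.
move=> /andP[r0 r1] e0.
have [l0 _ lP] := @exists_expr_ge R r^-1 e^-1 (ltac:(rewrite invf_gt1//; lra)).
exists l0 => l ll; apply: (@le_trans _ _ (r ^+ l0)).
  by rewrite ler_wiXn2l// ltW.
by move: lP; rewrite exprVn lef_pV2 ?posrE ?exprn_gt0.
Qed.

Lemma diam_ge0 (R : realType) (U : set R) (c : R) : U c -> (0 <= diam U)%E.
Proof. by move=> Uc; apply: ereal_sup_ubound; exists (c, c) => //=; rewrite subrr normr0. Qed.

Lemma dist_le_diam (R : realType) (U : set R) (x c : R) : U x -> U c ->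
  (`|x - c|%:E <= diam U)%E.
Proof. by move=> Ux Uc; apply: ereal_sup_ubound; exists (x, c). Qed.

Lemma diam_pow_ge0 (R : realType) (s : R) (U : set R) : (0 <= diam_pow s U)%E.
Proof. by rewrite /diam_pow; case: ifP => // _; exact: poweR_ge0. Qed.

(** The slack [e] pays for empty sets and single points, which have no dyadic scale of their own: as
    s' > 0, a large exponent is cheap. The strict inequality leaves room for open balls. *)
Lemma small_set_scale (R : realType) (s s' e : R) (U : set R) :
  0 <= s <= s' -> 0 < s' < 1 -> 0 < e -> (diam U <= (1 / 2)%:E)%E ->
  exists i : R * nat, [/\ forall x, U x -> `|x - i.1| < 2 ^- i.2 &
    (((2 `^ (- s')) ^+ i.2)%:E <= 2%:E * diam_pow s U + e%:E)%E].
Proof.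
move=> /andP[s0 ss'] s'01 e0 dU; have /andP[s'0 s'1] := s'01.
have /andP[a2 a1] := contraction_base s'01.
have [l0 l0P] := @exists_expr_le R (2 `^ (- s')) e (ltac:(apply/andP; split; lra)) e0.
have small : ((2 `^ (- s')) ^+ l0 <= e)%R by exact: l0P.
rewrite /diam_pow; case: eqP => [->|/eqP/set0P[c Uc]].
  by exists (0, l0); split => //=; rewrite mule0 add0e lee_fin.
have d0 := diam_ge0 Uc.
have [D DE] : exists D, diam U = D%:E.
  by move: d0 dU; case: (diam U) => // D _ _; exists D.
rewrite DE in d0 dU; rewrite !lee_fin in d0 dU.
have UD x : U x -> `|x - c| <= D by move=> Ux; have := dist_le_diam Ux Uc; rewrite DE lee_fin.
rewrite DE poweR_EFin.
move: d0; rewrite le_eqVlt => /orP[/eqP D0|D0].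
  exists (c, l0); split => /=.
    by move=> x /UD; rewrite -D0 => h; rewrite (le_lt_trans h)// invr_gt0 exprn_gt0.
  by rewrite -EFinM -EFinD lee_fin (le_trans small)// lerDr mulr_ge0// powR_ge0.
have D01 : 0 < D < 1 by rewrite D0/=; lra.
have [l /andP[Dl lD]] := dyadic_scale D01.
exists (c, l); split => /=; first by move=> x /UD h; exact: le_lt_trans Dl.
rewrite -EFinM -EFinD lee_fin (le_trans (@scale_powR_le R D s' l D0 _ lD)) ?(ltW s'0) ?(ltW s'1)//.
apply: (@le_trans _ _ (2 * D `^ s)); last by rewrite lerDl ltW.
rewrite ler_wpM2l// powR_le1_antitone//; apply/andP; split; lra.
Qed.

Lemma sum_half_powers_le (R : realType) (N : nat) : \sum_(n < N) 2 ^- n.+1 <= 1 :> R.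
Proof.
have -> : \sum_(n < N) 2 ^- n.+1 = 1 - 2 ^- N :> R.
  elim: N => [|N IH]; first by rewrite big_ord0 expr0 invr1 subrr.
  rewrite big_ord_recr/= IH exprS; field; exact: expf_neq0.
by rewrite lerBlDr lerDl invr_ge0 exprn_ge0.
Qed.

(** A countable cover of s-cost below kappa / 4 at most doubles its cost when rounded to dyadic
    radii, and the slacks add at most kappa / 2. Compactness then leaves finitely many balls. *)
Lemma hausdorff_null_thin_cover (R : realType) (A : set R) (s : R) :
  compact A -> 0 <= s < 1 -> hausdorff_measure s A = 0%E ->
  exists2 a : R, 1 / 2 < a < 1 & forall kappa : R, 0 < kappa ->
    exists2 I : seq (R * nat), \sum_(i <- I) a ^+ i.2 <= kappa &
      forall x, A x -> exists2 i, i \in I & `|x - i.1| <= 2 ^- i.2.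
Proof.
move=> cA /andP[s0 s1] mA0.
pose s' := (s + 1) / 2.
have s'01 : 0 < s' < 1 by rewrite /s'; apply/andP; split; lra.
have ss' : 0 <= s <= s' by rewrite s0/= /s'; lra.
exists (2 `^ (- s')); first exact: contraction_base.
move=> kappa k0.
have k4 : 0 < kappa / 4 by rewrite divr_gt0.
have : (hausdorff_content s (1 / 2) A < (kappa / 4)%:E)%E.
  apply: (@le_lt_trans _ _ 0%E); last by rewrite lte_fin.
  by rewrite -mA0; apply: ereal_sup_ubound; exists (1 / 2) => //=; lra.
move=> /ereal_inf_lt[_ [U [AU Ud] <-] Usum].
have ke n : 0 < kappa / 2 * 2 ^- n.+1.
  by rewrite !mulr_gt0// ?invr_gt0// exprn_gt0.
have /choice[i iP] := fun n => small_set_scale ss' s'01 (ke n) (Ud n).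
have [N NP] : exists N, forall x, A x -> exists2 n, (n < N)%N & `|x - (i n).1| <= 2 ^- (i n).2.
  move: cA; rewrite compact_cover => /(_ _ [set: nat] (fun n => ball (i n).1 (2 ^- (i n).2 : R))).
  case.
  - by move=> n _; apply: ball_open; rewrite invr_gt0 exprn_gt0.
  - move=> x /AU[n _ Ux]; exists n => //=.
    by rewrite /ball/= distrC; exact: (iP n).1.
  move=> D' _ D'P; exists (\max_(n <- finmap.enum_fset D') n).+1%N => x /D'P[n /= nD xn]; exists n.
    by rewrite ltnS; exact: (@leq_bigmax_seq _ _ predT id n nD isT).
  by move: xn; rewrite /ball/= distrC; exact: ltW.
exists [seq i n | n <- iota 0 N]; last first.
  move=> x /NP[n nN xn]; exists (i n) => //.
  by apply: map_f; rewrite mem_iota.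
rewrite big_map -[N]subn0 -/(index_iota 0 N) big_mkord.
have : ((\sum_(n < N) (2 `^ (- s')) ^+ (i n).2)%:E <=
    2%:E * (\sum_(n < N) diam_pow s (U n)) + (kappa / 2)%:E)%E.
  rewrite -sumEFin.
  apply: (@le_trans _ _ (\sum_(n < N)
     (2%:E * diam_pow s (U n) + (kappa / 2 * 2 ^- n.+1)%:E))%E).
    by apply: lee_sum => n _; exact: (iP n).2.
  rewrite big_split/= ge0_sume_distrr; last by move=> *; exact: diam_pow_ge0.
  rewrite leeD2l// sumEFin lee_fin -mulr_sumr ler_piMr ?sum_half_powers_le//.
  by rewrite divr_ge0 ?(ltW k0).
have : (\sum_(n < N) diam_pow s (U n) <= (kappa / 4)%:E)%E.
  apply: le_trans (ltW Usum).
  rewrite -(big_mkord xpredT (fun n => diam_pow s (U n))).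
  by apply: nneseries_lim_ge => n _ _; exact: diam_pow_ge0.
have : (0 <= \sum_(n < N) diam_pow s (U n))%E by apply: sume_ge0 => n _; exact: diam_pow_ge0.
case: (\sum_(n < N) diam_pow s (U n))%E => // r _; rewrite !lee_fin; lra.
Qed.

(** * Grid covers, and the bounds for the two dimensions *)

Lemma diam_le (R : realType) (U : set R) (r : R) :
  (forall x y, U x -> U y -> `|x - y| <= r) -> (diam U <= r%:E)%E.
Proof. by move=> Ur; apply: ge_ereal_sup => _ [[x y] [/= Ux Uy] <-]; rewrite lee_fin Ur. Qed.

Definition grid_cell (R : realType) (N n : nat) : set R :=
  [set x | n%:R / N%:R <= x <= n.+1%:R / N%:R].

(** The range up to 2 accommodates sums of two fractional parts that are not reduced modulo 1. *)
Lemma grid_cell_cover (R : realType) (N : nat) (x : R) : (0 < N)%N ->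
  0 <= x < 2 -> exists2 n, (n < 2 * N)%N & @grid_cell R N n x.
Proof.
move=> N0 /andP[x0 x2].
have NR : 0 < N%:R :> R by rewrite ltr0n.
have xN0 : 0 <= x * N%:R by rewrite mulr_ge0// ltW.
have /andP[n1 n2] := truncn_itv xN0.
exists (Num.truncn (x * N%:R)).
  by rewrite -(ltr_nat R) natrM (le_lt_trans n1)// ltr_pM2r.
by rewrite /grid_cell /= ler_pdivrMr// n1/= ler_pdivlMr// ltW.
Qed.

Lemma diam_grid_cell (R : realType) (N n : nat) : (diam (@grid_cell R N n) <= (N%:R^-1)%:E)%E.
Proof.
apply: diam_le => x y /= /andP[x1 x2] /andP[y1 y2].
have E : n.+1%:R / N%:R = n%:R / N%:R + N%:R^-1 :> R by rewrite -natr1 mulrDl mul1r.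
by move: x2 y2; rewrite E => x2 y2; rewrite ler_norml; apply/andP; split; lra.
Qed.

Lemma hausdorff_content_le (R : realType) (A : set R) (s delta : R) (N : nat) :
  0 <= s -> (0 < N)%N -> N%:R^-1 <= delta -> A `<=` [set x | 0 <= x < 2] ->
  (hausdorff_content s delta A <= (2 * N%:R * (N%:R^-1) `^ s)%:E)%E.
Proof.
move=> s0 N0 Nd A2.
(* The finite grid is padded with empty sets, to which [diam_pow] gives cost 0. *)
pose U n := if (n < 2 * N)%N then @grid_cell R N n else set0.
have dU n : (diam (U n) <= (N%:R^-1)%:E)%E.
  rewrite /U; case: ifP => _; first exact: diam_grid_cell.
  by apply: diam_le.
have dp n : (diam_pow s (U n) <= ((n < 2 * N)%N%:R * (N%:R^-1) `^ s)%:E)%E.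
  rewrite /diam_pow; case: eqP => [_|/eqP/set0P[c Uc]].
    by rewrite lee_fin mulr_ge0// powR_ge0.
  have nN : (n < 2 * N)%N by move: Uc; rewrite /U; case: ifP.
  rewrite nN mul1r; have := dU n; have := diam_ge0 Uc.
  case: (diam _) => // r; rewrite poweR_EFin !lee_fin => r0 rN.
  by apply: ge0_ler_powR; rewrite ?nnegrE ?invr_ge0.
apply: (@le_trans _ _ (\sum_(0 <= n <oo) diam_pow s (U n))%E).
  apply: ereal_inf_lbound; exists U => //; split.
    move=> x /A2 x2; have [n nN xn] := grid_cell_cover N0 x2.
    by exists n => //; rewrite /U nN.
  by move=> n; apply: le_trans (dU n) _; rewrite lee_fin.
apply: lime_le.
  by apply: is_cvg_nneseries => n _ _; exact: diam_pow_ge0.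
apply: nearW => m; apply: (@le_trans _ _ (\sum_(0 <= n < m)
    ((n < 2 * N)%N%:R * (N%:R^-1) `^ s)%:E)%E).
  by apply: lee_sum => n _; exact: dp.
rewrite sumEFin lee_fin -mulr_suml ler_wpM2r ?powR_ge0//.
rewrite -natrM -natr_sum ler_nat.
have cnt k : (\sum_(0 <= n < k) (n < 2 * N) <= minn k (2 * N))%N.
  elim: k => [|k IHk]; first by rewrite big_geq.
  by rewrite big_nat_recr//=; move: IHk; case: (ltnP k); lia.
by apply: leq_trans (cnt m) _; exact: geq_minr.
Qed.

(** For s = 1 + e a grid of mesh 1 / N costs at most 2 N^-e, which tends to 0 along N = 2^l. *)
Lemma hausdorff_dim_le1 (R : realType) (A : set R) :
  A `<=` [set x | 0 <= x < 2] -> (hausdorff_dim A <= 1)%E.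
Proof.
move=> A2; apply/lee_addgt0Pr => e e0.
apply: ereal_inf_lbound; exists (1 + e) => //=; split; first by lra.
set s := 1 + e; have s0 : 0 <= s by rewrite /s; lra.
apply/eqP; rewrite eq_le; apply/andP; split; last first.
  apply: (@le_trans _ _ (hausdorff_content s 1 A)).
    apply: le_ereal_inf_tmp => _ [U _ <-]; apply: nneseries_ge0 => n _ _.
    exact: diam_pow_ge0.
  by apply: ereal_sup_ubound; exists 1 => //=.
apply: ge_ereal_sup => _ [delta /= delta0 <-].
apply/lee_addgt0Pr => k k0; rewrite add0e.
have l2 : 0 < ln 2 :> R by rewrite ln_gt0// ltr1n.
have r01 : 0 < (2 : R) `^ (- e) < 1.
  rewrite powR_gt0//= /powR pnatr_eq0/= expR_lt1 pmulr_llt0// oppr_lt0//.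
have k20 : 0 < k / 2 by lra.
have h01 : 0 < (1 / 2 : R) < 1 by apply/andP; split; lra.
have [l1 l1P] := exists_expr_le r01 k20.
have [l3 l3P] := exists_expr_le h01 delta0.
pose l := (maxn l1 l3).
have N0 : (0 < 2 ^ l)%N by rewrite expn_gt0.
have Nd : (2 ^ l)%N%:R^-1 <= delta.
  by rewrite natrX -exprVn -[2^-1]mul1r; apply: l3P; exact: leq_maxr.
apply: (le_trans (hausdorff_content_le s0 N0 Nd A2)).
rewrite lee_fin -mulrA mulrC -ler_pdivlMr//.
apply: le_trans (l1P l (leq_maxl _ _)).
have -> : (2 `^ (- e)) ^+ l = ((2 ^ l)%N%:R^-1) `^ e :> R.
  rewrite natrX -powR_mulrn ?powR_ge0// -powRrM mulrC mulrN -mulNr powRrM.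
  by rewrite powRN powR_mulrn.
rewrite /s powRD; last by rewrite invr_eq0 pnatr_eq0 -lt0n N0 implybT.
by rewrite powRr1 ?invr_ge0// mulrA mulfV ?mul1r// pnatr_eq0 -lt0n.
Qed.

Lemma covering_number_le (R : realType) (A : set R) (delta : R) (N : nat) :
  (0 < N)%N -> N%:R^-1 <= delta -> A `<=` [set x | 0 <= x < 2] ->
  (covering_number A delta <= ((2 * N)%N%:R)%:E)%E.
Proof.
move=> N0 Nd A2; apply: ereal_inf_lbound; exists (2 * N)%N => //=.
exists (fun i => @grid_cell R N i); split; last first.
  by move=> i; apply: (le_trans (diam_grid_cell _ _ _)); rewrite lee_fin.
by move=> x /A2 /(grid_cell_cover N0)[n nN xn]; exists (Ordinal nN).
Qed.

Lemma covering_number_ge1 (R : realType) (A : set R) (delta : R) :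
  A !=set0 -> (1 <= covering_number A delta)%E.
Proof.
move=> [x Ax]; apply: le_ereal_inf_tmp => _ [[|n] [U [AU _]] <-].
  by have [[]] := AU x Ax.
by rewrite lee_fin ler1n.
Qed.

Lemma lower_box_dim_ge0 (R : realType) (A : set R) : A !=set0 -> (0 <= lower_box_dim A)%E.
Proof.
move=> A0; rewrite /lower_box_dim limf_einfE.
apply: (@le_trans _ _ (ereal_inf [set (lne (covering_number A delta) / (- ln delta)%:E)%E
   | delta in [set delta : R | 0 < delta < 1]])); last first.
  apply: ereal_sup_ubound; exists [set delta | 0 < delta < 1] => //.
  near=> x => /=; apply/andP; split; near: x; [exact: nbhs_right_gt|exact: nbhs_right_lt].
apply: le_ereal_inf_tmp => _ [delta /= /andP[d0 d1] <-].
have L0 : 0 < - ln delta by rewrite oppr_gt0 ln_lt0// d0.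
rewrite inver gt_eqF// mule_ge0 ?lee_fin ?invr_ge0 ?(ltW L0)// lne_ge0.
exact: covering_number_ge1.
Unshelve. all: by end_near.
Qed.

(** At scale [x] at most 4 / x cells suffice, so the quotient is at most 1 + ln 4 / (- ln x). *)
Lemma lower_box_dim_le1 (R : realType) (A : set R) :
  A `<=` [set x | 0 <= x < 2] -> (lower_box_dim A <= 1)%E.
Proof.
move=> A2; rewrite /lower_box_dim limf_einfE.
apply: ge_ereal_sup => _ [V V0 <-]; apply/lee_addgt0Pr => e e0.
have l4 : 0 < ln 4 :> R by rewrite ln_gt0// ltr1n.
have : \forall x \near (0 : R)^'+, [/\ V x, 0 < x, x < 1 & x < expR (- (ln 4 / e))].
  near=> x; split; near: x; [exact: V0|exact: nbhs_right_gt|exact: nbhs_right_lt|].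
  by apply: nbhs_right_lt; exact: expR_gt0.
move=> /filter_ex[x [Vx x0 x1 xe]].
apply: ge_ereal_inf; exists (lne (covering_number A x) / (- ln x)%:E)%E; first by exists x.
have L0 : 0 < - ln x by rewrite oppr_gt0 ln_lt0// x0.
rewrite inver gt_eqF// lee_pdivrMr//.
pose N := (Num.truncn x^-1).+1.
have xi1 : 1 < x^-1 by rewrite invf_gt1.
have Nx : N%:R^-1 <= x.
  by rewrite -[leRHS]invrK lef_pV2 ?posrE ?invr_gt0// ltW// truncnS_gt.
have N2 : (2 * N)%N%:R <= 4 / x.
  have : (Num.truncn x^-1)%:R <= x^-1 by rewrite truncn_le// ltW// invr_gt0.
  by rewrite natrM /N -natr1; lra.
have ax : 0 < 4 / x by rewrite divr_gt0.
apply: (@le_trans _ _ (lne (4 / x)%:E)).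
  have c0 : (0 <= covering_number A x)%E.
    by apply: le_ereal_inf_tmp => _ [n _ <-]; rewrite lee_fin.
  rewrite lee_lne; [|by rewrite in_itv/= c0 leey|by rewrite in_itv/= leey lee_fin ltW].
  apply: le_trans (@covering_number_le R A x N isT Nx A2) _.
  by rewrite lee_fin.
rewrite lne_EFin// -EFinD -EFinM lee_fin ln_div ?posrE//.
rewrite mulrDl mul1r addrC lerD2l -ler_pdivrMl//.
rewrite lerNr -[leRHS]expRK mulrC ler_ln ?posrE ?expR_gt0//; exact: ltW.
Unshelve. all: by end_near.
Qed.

(** Otherwise, for some s < 1 and arbitrarily small delta, fewer than delta^-s sets suffice. Given
    one common exponent [l] and weighted with s' > s, they have total weight at most 2 delta^(s' -
    s), against [no_thin_cover]. Integer parts do not matter, since [near1] ignores them. *)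
Lemma lower_box_dim_ge1 (R : realType) (p : {poly R}) (d : R) :
  (exists i : nat, (1 <= i)%N /\ irrational p`_i) ->
  (1 <= lower_box_dim (value_set (fun n => mod1 p.[n%:R] + mod1 (2 ^+ n * d))%R))%E.
Proof.
move=> hp; set A := value_set _; rewrite leNgt; apply/negP.
rewrite /lower_box_dim limf_einfE => lt1.
have [s [s2 s1 sP]] : exists s : R, [/\ 1 / 2 <= s, s < 1 &
    forall eta : R, 0 < eta -> exists2 delta, 0 < delta < eta &
      (lne (covering_number A delta) / (- ln delta)%:E < s%:E)%E].
  move: lt1; set S := ereal_sup _ => lt1.
  have [s0 [s01 Ss0]] : exists s0 : R, s0 < 1 /\ (S < s0%:E)%E.
    case E : S lt1 => [r| |] //; last by exists 0; rewrite ltr01 ltNyr.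
    by rewrite lte_fin => r1; exists ((r + 1) / 2); rewrite lte_fin; split; lra.
  (* The dimension bound [s0] may be negative; the maximum with 1/2 keeps the exponent [s']
     positive. *)
  exists (Num.max s0 (1 / 2)); split.
  - by rewrite le_max lexx orbT.
  - by rewrite gt_max s01/=; lra.
  move=> eta eta0.
  have : (ereal_inf [set (lne (covering_number A delta) / (- ln delta)%:E)%E
     | delta in [set delta : R | (0 < delta < eta)%R]] < s0%:E)%E.
    apply: le_lt_trans Ss0; apply: ereal_sup_ubound; exists [set delta | 0 < delta < eta] => //.
    by near=> x => /=; apply/andP; split; near: x;
      [exact: nbhs_right_gt|exact: nbhs_right_lt].
  move=> /ereal_inf_lt[_ [delta /= d0 <-] h]; exists delta => //.
  by apply: (lt_le_trans h); rewrite lee_fin le_max lexx.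
pose s' := (s + 1) / 2.
have s'01 : 0 < s' < 1 by rewrite /s'; apply/andP; split; lra.
have [kappa k0 kP] := no_thin_cover d hp (contraction_base s'01).
(* Below this scale 2 delta^(s' - s) is at most [kappa]. *)
pose eta := Num.min (1 / 2) ((kappa / 2) `^ (s' - s)^-1).
have eta0 : 0 < eta by rewrite lt_min powR_gt0 ?divr_gt0// andbT; lra.
have [delta /andP[d0]] := sP eta eta0.
rewrite lt_min => /andP[d2 dk] h.
have d1 : delta < 1 by lra.
have L0 : 0 < - ln delta by rewrite oppr_gt0 ln_lt0// d0.
move: h; rewrite inver gt_eqF// lte_pdivrMr// -EFinM => h.
have : (covering_number A delta < (delta `^ (- s))%:E)%E.
  have c0 : (0 <= covering_number A delta)%E.
    by apply: le_ereal_inf_tmp => _ [n _ <-]; rewrite lee_fin.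
  rewrite -lte_lne; last 2 first.
  - by rewrite in_itv/= c0 leey.
  - by rewrite in_itv/= leey lee_fin powR_ge0.
  by rewrite lne_EFin ?powR_gt0// ln_powR mulNr -mulrN.
move=> /ereal_inf_lt[_ [n /= [U [AU dU]] <-]]; rewrite lte_fin => nlt.
have [l /andP[dl ld]] := @dyadic_scale R delta (ltac:(by rewrite d0 d1)).
have /choice[c cP] : forall i, exists c : R, forall x, U i x -> `|x - c| <= 2 ^- l.
  move=> i; have [U0|/eqP/set0P[c Uc]] := pselect (U i = set0).
    by exists 0 => x; rewrite U0.
  exists c => x Ux; apply: le_trans (ltW dl).
  by have := le_trans (dist_le_diam Ux Uc) (dU i); rewrite lee_fin.
apply: (kP [seq (c i, l) | i <- enum 'I_n]).
  rewrite big_map big_enum/= sumr_const card_ord -(mulr_natl (_ ^+ l)).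
  apply: (@le_trans _ _ (delta `^ (- s) * (2 * delta `^ s'))).
    apply: ler_pM; rewrite ?exprn_ge0 ?powR_ge0 ?(ltW nlt)//.
    by apply: scale_powR_le => //; have /andP[] := s'01; move=> *; apply/andP; split; lra.
  have -> : delta `^ (- s) * (2 * delta `^ s') = 2 * delta `^ (s' - s).
    by rewrite mulrCA -powRD ?(gt_eqF d0) ?implybT// (addrC (- s)).
  rewrite -ler_pdivlMl// mulrC.
  have ss : 0 < s' - s by rewrite /s'; lra.
  have -> : kappa / 2 = ((kappa / 2) `^ (s' - s)^-1) `^ (s' - s).
    by rewrite -powRrM mulVf ?gt_eqF// powRr1 ?divr_ge0// ltW.
  by apply: ge0_ler_powR; rewrite ?nnegrE ?powR_ge0// ltW.
move=> m m1.
have Am : A (mod1 p.[m%:R] + mod1 (2 ^+ m * d)) by exists m.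
have [i _ Ui] := AU _ Am.
exists (c i, l); first by apply: map_f; rewrite mem_enum.
have [u uE] := mod1_near p.[m%:R]; have [v vE] := mod1_near (2 ^+ m * d).
exists (u + v); have := cP i _ Ui; rewrite uE vE intrD /=.
by congr (`|_| <= _); ring.
Unshelve. all: by end_near.
Qed.

Lemma hausdorff_dim_closure_ge1 (R : realType) (p : {poly R}) (d : R) :
  (exists i : nat, (1 <= i)%N /\ irrational p`_i) ->
  (1 <= hausdorff_dim (closure (value_set (fun n => mod1 (p.[n%:R] + 2 ^+ n * d))%R)))%E.
Proof.
move=> hp; set V := value_set _.
have V01 : closure V `<=` `[0, 1].
  rewrite closureE => x; apply; split; first exact: itv_closed.
  by move=> _ [n _ <-]; have /andP[a b] := mod1_bounds (p.[n%:R] + 2 ^+ n * d);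
    rewrite /= in_itv/= a ltW.
apply: le_ereal_inf_tmp => _ [s [s0 ms] <-]; rewrite lee_fin leNgt; apply/negP => s1.
have cV : compact (closure V).
  apply: subclosed_compact V01; [exact: closed_closure|exact: segment_compact].
have s01 : 0 <= s < 1 by rewrite s0.
have [a a21 aP] := hausdorff_null_thin_cover cV s01 ms.
have [kappa k0 kP] := no_thin_cover d hp a21.
have [I Ik IP] := aP _ k0.
apply: (kP I Ik) => n n1.
have [i iI ni] := IP (mod1 (p.[n%:R] + 2 ^+ n * d)) (subset_closure (ex_intro2 _ _ n n1 erefl)).
exists i => //; have [m mE] := mod1_near (p.[n%:R] + 2 ^+ n * d).
by exists m; move: ni; rewrite mE addrAC.
Qed.

Theorem mainTheorem1 (R : realType) (p : {poly R}) (d : R)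
    (hp : exists i : nat, (1 <= i)%N /\ irrational p`_i) :
  arithmetically_independent
    (fun n => mod1 p.[n%:R]) (fun n => mod1 (2 ^+ n * d)) /\
  hausdorff_dim
    (closure (value_set (fun n => mod1 (p.[n%:R] + 2 ^+ n * d)))) = 1%E.
Proof.
have bnd (x : R) : 0 <= mod1 x <= 1 by have /andP[-> /ltW ->] := mod1_bounds x.
split; last first.
  apply/eqP; rewrite eq_le hausdorff_dim_closure_ge1// andbT.
  apply: hausdorff_dim_le1; apply: (@subset_trans _ `[0, 1]).
    rewrite closureE => x; apply; split; first exact: itv_closed.
    by move=> _ [n _ <-]; rewrite /= in_itv/=.
  by move=> x /=; rewrite in_itv/= => /andP[-> x1]/=; lra.
split; [by move=> n _; exact: bnd|by move=> n _; exact: bnd|].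
have X1 : (1 <= lower_box_dim (value_set (fun n => mod1 p.[n%:R])))%E.
  (* For [d = 0] the second summand vanishes identically. *)
  have := lower_box_dim_ge1 0 hp; congr (_ <= lower_box_dim (value_set _))%E.
  apply/funext => n; rewrite mulr0 (@mod1_eq _ 0 0 0) ?addr0//.
  by rewrite lexx ltr01.
have Y0 : (0 <= lower_box_dim (value_set (fun n => mod1 (2 ^+ n * d))%R))%E.
  by apply: lower_box_dim_ge0; exists (mod1 (2 ^+ 1 * d)); exists 1%N.
rewrite min_l; last exact: le_trans X1 (leeDl _ Y0).
apply/eqP; rewrite eq_le lower_box_dim_ge1// andbT.
apply: lower_box_dim_le1 => _ [n _ <-] /=.
have /andP[a b] := mod1_bounds p.[n%:R]; have /andP[a' b'] := mod1_bounds (2 ^+ n * d).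
by apply/andP; split; lra.
Qed.
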